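(* Let $\Sigma$ be a finite subset of $\mathbb N^*$ with $|\Sigma|<q$. Then the map $\mathcal F_\Sigma$ induces an isomorphism of graded $\mathcal Z_\emptyset$-modules $\mathcal Z_\Sigma\xrightarrow{\ \mathcal F_\Sigma\ }\mathcal L_\Sigma$.
   Context: Notation. $p$ is a prime, $q=p^e$ with $e\ge1$; $\mathbb N=\mathbb Z_{\ge0}$, $\mathbb N^*=\mathbb Z_{>0}$; $A=\mathbb F_q[\theta]$, $K=\mathbb F_q(\theta)$, $\mathbb C_\infty$ is the completion of an algebraic closure of $\mathbb F_q((1/\theta))$; $A^+$ is the set of monic polynomials of $A$. For $a\in A$, $a(t)\in\mathbb F_q[t]$ is obtained by replacing $\theta$ by $t$. $D_i=\prod_{j=0}^{i-1}(\theta^{q^i}-\theta^{q^j})$, $l_i=\prod_{j=1}^{i}(\theta-\theta^{q^j})$, $D_0=l_0=1$. $\mathfrak S$ is the set of maps $\Sigma:\mathbb N^*\to\mathbb N$ with finite support, with product $(\Sigma\cdot\Sigma')(x)=\Sigma(x)+\Sigma'(x)$ and neutral element $\emptyset$ (the zero map); finite subsets of $\mathbb N^*$ are identified with their characteristic functions. An admissible composition array of $\binom{\Sigma}{n}$ is a matrix $\mathcal C=\begin{pmatrix}\Sigma_1&\cdots&\Sigma_r\\ n_1&\cdots&n_r\end{pmatrix}$ with $r\ge1$, $\Sigma_i\in\mathfrak S$, $n_i\in\mathbb N^*$, $\Sigma_1\cdots\Sigma_r=\Sigma$, $\sum n_i=n$; in addition $\binom{\emptyset}{0}$ is admissible (depth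 $0$). $\zeta_A(\mathcal C)=\sum_{a_1,\dots,a_r\in A^+,\ |a_1|>\cdots>|a_r|}\frac{\chi_{\Sigma_1}(a_1)\cdots\chi_{\Sigma_r}(a_r)}{a_1^{n_1}\cdots a_r^{n_r}}$ with $\chi_\Sigma(a)=\prod_i a(t_i)^{\Sigma(i)}$, $\zeta_A\binom{\emptyset}{0}=1$. These belong to the $\mathbb C_\infty$-algebra $\mathbb E_\Sigma$ of entire functions $\mathbb C_\infty^\Sigma\to\mathbb C_\infty$ in the $t_i$, $i\in\Sigma$. $\mathcal Z_{n,\Sigma}$ is the $\mathbb F_p$-span of the $\zeta_A(\mathcal C)$ with $\mathcal C$ admissible of $\binom{\Sigma}{n}$; $\mathcal Z_\Sigma=\sum_{n\ge0}\mathcal Z_{n,\Sigma}$, graded by $n$. $\mathcal Z_\emptyset$ is the $\mathbb F_p$-algebra of Thakur's multiple zeta values; it acts by multiplication. With $S_d(n)=\sum_{a\in A^+,\deg a=d}a^{-n}$, $\lambda_A(\mathcal C)=\sum_{d_1>\cdots>d_r\ge0}S_{d_1}(n_1)\cdots S_{d_r}(n_r)\prod_{i\in\mathbb N^*}X_i^{\sum_{j=1}^r\Sigma_j(i)q^{d_j}}$, $\lambda_A\binom{\emptyset}{0}=1$. $\mathcal L_{n,\Sigma}$ is the $\mathbb F_p$-span of the $\lambda_A(\mathcal C)$ with $\mathcal C$ admissible of $\binom{\Sigma}{n}$; $\mathcal L_\Sigma=\sum_{n\ge0}\mathcal L_{n,\Sigma}$, graded by $n$, with $\mathcal Z_\emptyset=\mathcal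 L_\emptyset$ acting by multiplication. Map $\mathcal F_\Sigma:\mathbb E_\Sigma\to\mathbb C_\infty[[X_j:j\in\Sigma]]$: for $\underline i=(i_j)_{j\in\Sigma}\in\mathbb N^\Sigma$ put $\underline\theta^{q^{\underline i}}=(\theta^{q^{i_j}})_{j\in\Sigma}$, $f_{\underline i}=\sum_{\underline j\le\underline i}f(\underline\theta^{q^{\underline j}})\prod_{k\in\Sigma}D_{j_k}^{-1}l_{i_k-j_k}^{-q^{j_k}}$ (componentwise order), and $\mathcal F_\Sigma(f)=\sum_{\underline i\in\mathbb N^\Sigma}f_{\underline i}\prod_{j\in\Sigma}X_j^{q^{i_j}}$. *)

(* Defs.v *)
From HB Require Import structures.
From mathcomp Require Import all_boot all_order all_algebra finmap.
From mathcomp Require Import all_classical all_reals all_analysis.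

Set Implicit Arguments.
Unset Strict Implicit.
Unset Printing Implicit Defensive.

Import Order.TTheory GRing.Theory Num.Theory.
Import numFieldNormedType.Exports.

Local Open Scope classical_set_scope.
Local Open Scope ring_scope.

Definition Npos := {n : nat | (0 < n)%N}.

Definition fmaps := {fsfun Npos -> nat with 0%N}.

Definition charf (S : {fset Npos}) : fmaps := [fsfun x in S => 1%N].

(* An array is the list of its columns (Sigma_j, n_j).  The empty list is the
   array of depth 0; it is admissible exactly for Sigma = 0 and n = 0. *)
Definition array := seq (fmaps * nat).

Definition admissible (Sigma : fmaps) (n : nat) (M : array) : Prop :=
  [/\ forall c, c \in M -> (0 < c.2)%N,
      forall x, (\sum_(c <- M) c.1 x)%N = Sigma x
    & (\sum_(c <- M) c.2)%N = n].

Section GradedModules.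
Variable C : fieldType.

(* When char C = p, the residue c in F_p acts on V as the natural number c. *)
Definition Fp_span (p : nat) (V : lmodType C) (X : set V) : set V :=
  [set v | exists m (c : 'I_m -> 'F_p) (x : 'I_m -> V),
     (forall k, X (x k)) /\ v = \sum_(k < m) ((c k : nat)%:R : C) *: x k].

Definition gsum (V : lmodType C) (M : nat -> set V) : set V :=
  [set v | exists N (x : nat -> V),
     (forall n, M n (x n)) /\ v = \sum_(n < N) x n].

Record graded_module (A : nat -> set C^o) (V : lmodType C)
    (M : nat -> set V) : Prop := GradedModule {
  gmod0 : forall n, M n 0;
  gmodB : forall n u v, M n u -> M n v -> M n (u - v);
  gmodZ : forall m n a v, A m a -> M n v -> M (m + n)%N ((a : C) *: v) }.

Record graded_module_iso (A : nat -> set C^o) (V W : lmodType C)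
    (M : nat -> set V) (N : nat -> set W) (f : V -> W) : Prop :=
  GradedModuleIso {
  giso_source : graded_module A M;
  giso_target : graded_module A N;
  gisoD : forall u v, gsum M u -> gsum M v -> f (u + v) = f u + f v;
  gisoZ : forall a v, gsum A a -> gsum M v -> f ((a : C) *: v) = (a : C) *: f v;
  giso_bij : set_bij (gsum M) (gsum N) f;
  giso_deg : forall n, f @` M n = N n }.

End GradedModules.

Section Carlitz.
Variables (R : realType) (F : finFieldType) (C : fieldType).
Variables (inF : {rmorphism F -> C}) (theta : C) (absv : C -> R).

Local Notation q := #|F|.

Definition converges (u : nat -> C) (x : C) : Prop :=
  (fun n => absv (u n - x)) @ \oo --> (0 : R).

Definition cauchy_seq (u : nat -> C) : Prop :=
  forall eps : R, 0 < eps -> exists N, forall m n,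
    (N <= m)%N -> (N <= n)%N -> absv (u m - u n) < eps.

(* Unspecified for a divergent sequence. *)
Definition climit (u : nat -> C) : C := xget 0 [set x | converges u x].

(* F_q((1/theta)) inside C: the sums of the series
   theta^m * \sum_(k >= 0) c_k theta^-k with c_k in F_q. *)
Definition Kinf : set C :=
  [set x | exists (m : nat) (c : nat -> F),
     converges (fun N => theta ^+ m * \sum_(k < N) inF (c k) * theta ^- k) x].

Definition Kinf_alg : set C :=
  [set x | exists P : {poly C},
     [/\ P != 0, forall i, Kinf P`_i & root P x]].

(* C with absv is the completion of an algebraic closure of F_q((1/theta)),
   with absv normalised by |theta| = q. *)
Record is_Cinf : Prop := IsCinf {
  absv_ge0 : forall x, 0 <= absv x;
  absv_eq0 : forall x, absv x = 0 <-> x = 0;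
  absvM : forall x y, absv (x * y) = absv x * absv y;
  absvD : forall x y, absv (x + y) <= Num.max (absv x) (absv y);
  absv_theta : absv theta = q%:R;
  absv_complete : forall u, cauchy_seq u -> exists x, converges u x;
  Kinf_alg_closed : forall P : {poly C}, (forall i, Kinf_alg P`_i) ->
    (1 < size P)%N -> exists2 x, Kinf_alg x & root P x;
  Kinf_alg_dense : forall x (eps : R), 0 < eps ->
    exists2 y, Kinf_alg y & absv (x - y) < eps }.

Definition ev (a : {poly F}) (x : C) : C := (map_poly inF a).[x].

Definition Dc (i : nat) : C :=
  \prod_(j < i) (theta ^+ (q ^ i)%N - theta ^+ (q ^ j)%N).

Definition lc (i : nat) : C := \prod_(1 <= j < i.+1) (theta - theta ^+ (q ^ j)%N).

Definition powersum (d n : nat) : C :=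
  \sum_(a : {poly_d.+1 F} | ((a : {poly F}) \is monic) && (size a == d.+1))
     (ev a theta) ^- n.

Section Variables.
(* The variables t_i and X_i are indexed by i in S. *)
Variable S : {fset Npos}.

Definition CS_fun : lmodType C := ((S -> C) -> C^o : lmodType C).

(* A power series is the function giving the coefficient of each
   monomial X^m, m : S -> nat. *)
Definition pseries : lmodType C := ({ffun S -> nat} -> C^o : lmodType C).

Definition entire : set CS_fun :=
  [set f | exists c : {ffun S -> nat} -> C,
     (forall rho eps : R, 0 < rho -> 0 < eps ->
        finite_set [set al | eps <= absv (c al) * rho ^+ (\sum_k al k)%N]) /\
     (forall t, converges
        (fun N => \sum_(al : {ffun S -> 'I_N})
           c [ffun k => (al k : nat)] * \prod_k t k ^+ al k)
        (f t))].

Definition chi (Sigma : fmaps) (t : S -> C) (a : {poly F}) : C :=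
  \prod_(i : S) ev a (t i) ^+ Sigma (val i).

(* The sum over the a_j of degree < D; {poly_D F} is the finite type of
   polynomials of degree < D. *)
Definition zeta_partial (M : array) (t : S -> C) (D : nat) : C :=
  \sum_(a : (size M).-tuple {poly_D F} |
        all (fun b : {poly_D F} => (b : {poly F}) \is monic) a
        && sorted (fun b c : {poly_D F} => absv (ev c theta) < absv (ev b theta)) a)
    \prod_(j < size M)
       (chi (tnth (in_tuple M) j).1 t (tnth a j)
        / ev (tnth a j) theta ^+ (tnth (in_tuple M) j).2).

(* The series is summed by increasing degree of a_1: for |t_i| large the
   individual terms do not tend to 0, and the value of the entire function
   zeta_A(M) at t is the limit of these partial sums. *)
Definition zetaA (M : array) : CS_fun := fun t => climit (zeta_partial M t).

Definition lambda_partial (M : array) (m : {ffun S -> nat}) (D : nat) : C :=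
  \sum_(d : (size M).-tuple 'I_D |
        sorted (fun x y : 'I_D => (y < x)%N) d
        && [forall i, m i ==
              (\sum_(j < size M)
                 (tnth (in_tuple M) j).1 (val i) * q ^ tnth d j)%N])
    \prod_(j < size M) powersum (tnth d j) (tnth (in_tuple M) j).2.

(* Coefficientwise limit of the formal series. *)
Definition lambdaA (M : array) : pseries := fun m => climit (lambda_partial M m).

Definition Fcoef (f : CS_fun) (i : {ffun S -> nat}) : C :=
  \sum_(j : {dffun forall k : S, 'I_(i k).+1})
     f (fun k => theta ^+ (q ^ j k)%N)
     * \prod_k ((Dc (j k))^-1 * lc (i k - j k) ^- (q ^ j k)%N).

(* For each m there is at most one i with q ^ i_k = m_k for all k. *)
Definition Fmap (f : CS_fun) : pseries := fun m =>
  \sum_(i \in [set i : {ffun S -> nat} | forall k, m k = (q ^ i k)%N]) Fcoef f i.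

Definition Z_Sigma (p n : nat) : set CS_fun :=
  Fp_span p [set f | exists2 M, admissible (charf S) n M & f = zetaA M].

Definition L_Sigma (p n : nat) : set pseries :=
  Fp_span p [set g | exists2 M, admissible (charf S) n M & g = lambdaA M].

End Variables.

(* Without variables a function has a single argument, so that Z_(n, emptyset)
   is a subset of C. *)
Definition Z_empty (p n : nat) : set C^o :=
  [set f (fun=> 0) | f in @Z_Sigma fset0 p n].

End Carlitz.

Arguments entire {R C} absv S.
Arguments Z_Sigma {R F C} inF theta absv S p n.
Arguments L_Sigma {R F C} inF theta absv S p n.
Arguments Fmap F {C} theta S f.

(* Main.v *)
From HB Require Import structures.
Require Import Defs.
From mathcomp Require Import all_boot all_order all_algebra finmap.
From mathcomp Require Import finfield.
From mathcomp Require Import all_classical all_reals all_analysis.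
From mathcomp Require Import ring zify.

Set Implicit Arguments.
Unset Strict Implicit.
Unset Printing Implicit Defensive.

Import Order.TTheory GRing.Theory Num.Theory.
Local Open Scope ring_scope.

(** Let [b_d(t)] be the product of the [t - theta^(q^j)] for [j < d]. These
polynomials are the Newton basis for interpolation at the points
[theta^(q^j)], and the coefficients [f_i] in the definition of the map are the
Newton coefficients of [f], with one index for each variable ([nbasis_dual],
[Fcoef_newton]). So a series lambda is the image of the sum Lambda obtained
from it by replacing each [X_k^(q^d)] by [b_d(t_k)] ([Fmap_wsum]), and the
theorem amounts to two facts: in each weight the sums Lambda and the zeta
values span the same space over [F_p], and a function in this space is
determined by its Newton coefficients.

Both kinds of functions are limits of iterated sums over
[d_1 > ... > d_r >= 0] of products of letters. For the zeta values, the letter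
of a set of variables [U] and a weight [n] is the sum, over the monic [a] of
degree [d], of [a^-n] times the product of the [a(t_k)] for [k] in [U]; for
Lambda it is the power sum [S_d(n)] times the product of the [b_d(t_k)]. In
both systems the product of two letters with the same index [d] is a
combination over [F_p] of letters times iterated sums over smaller indices
([letter_mul], by partial fractions). Hence the iterated sums span an algebra
([words_mul]); multiplying by sums without variables gives the module
structure.

The two systems are compared by Newton interpolation: if [a] is monic of
degree [d], then [a(t)] is [b_d(t)] plus the sum of the [E_i(a) b_i(t)] for
[i < d], where [E_i] is the Carlitz polynomial, with coefficient [B_ij] at
[a^(q^j)] ([ev_newton]). The logarithmic derivative of [E_i] gives
[B_i0 = S_i(1)] and a recursion that writes [B_ij] as a combination over [F_p]
of iterated power sums of weight [q^j] ([carlitz_coef_rec]). After expanding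
the product of the [a(t_k)], the sum over [a] involves power sums whose
exponent is a sum of some [q^(j_k)], with [j_k < d], minus [n]. If this is
nonnegative it is less than [q^d - 1], as there are fewer than [q] variables,
and then the power sum is zero ([size_vprod], [powersum_reduce]). What is left
shows that a zeta letter is the Lambda letter of the same weight plus terms
that consist of letters and sums of smaller weight. This triangular relation
is inverted by induction on the weight ([words_zeta_lambda]).

As for convergence, the absolute value of [S_d(n)] is at most
[q^-(q + ... + q^d)], which is much smaller than the inverse of a product of
[q - 1] values of [b_d], each of size about [q^(1 + ... + q^(d-1))]
([tail_to0]). The estimate applies to values, to Newton coefficients and to
Taylor coefficients alike ([nestY_cauchy]). For Taylor coefficients it shows
that the limits are entire ([taylor_entire]); for Newton coefficients it shows
that a limit whose Newton coefficients are zero is zero ([newton_inj]). *)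

(** * Additive spans and word sums *)

(** In characteristic [p] the span over [F_p] is the additive subgroup generated
by [X], which has the induction principle that is used below. *)
Inductive zspan (V : zmodType) (X : V -> Prop) : V -> Prop :=
| zspan_in v : X v -> zspan X v
| zspan0 : zspan X 0
| zspanB u v : zspan X u -> zspan X v -> zspan X (u - v).

Section ZSpan.
Variables V W : zmodType.

Lemma zspanN (X : V -> Prop) u : zspan X u -> zspan X (- u).
Proof. by move=> Xu; rewrite -sub0r; apply: zspanB => //; apply: zspan0. Qed.

Lemma zspanD (X : V -> Prop) u v : zspan X u -> zspan X v -> zspan X (u + v).
Proof. by move=> Xu Xv; rewrite -[v]opprK; apply: zspanB => //; apply: zspanN. Qed.

Lemma zspan_sum (X : V -> Prop) I (r : seq I) (P : pred I) (f : I -> V) :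
  (forall i, P i -> zspan X (f i)) -> zspan X (\sum_(i <- r | P i) f i).
Proof.
by move=> Xf; elim/big_ind: _ => //; [exact: zspan0 | exact: zspanD].
Qed.

Lemma zspanMn (X : V -> Prop) u n : zspan X u -> zspan X (u *+ n).
Proof.
by move=> Xu; elim: n => [|n IH]; [exact: zspan0 | rewrite mulrS; exact: zspanD].
Qed.

Lemma zspan_map (X : V -> Prop) (Y : W -> Prop) (f : V -> W) :
  {morph f : u v / u - v} -> (forall u, X u -> zspan Y (f u)) ->
  forall u, zspan X u -> zspan Y (f u).
Proof.
move=> fB fX u; elim=> {u} [u /fX //||u v _ Yu _ Yv].
  by rewrite -(subr0 0) fB subrr; exact: zspan0.
by rewrite fB; exact: zspanB.
Qed.

End ZSpan.

Lemma zspan_sub (V : zmodType) (X Y : V -> Prop) :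
  (forall u, X u -> zspan Y u) -> forall u, zspan X u -> zspan Y u.
Proof. by move=> XY; apply: (@zspan_map V V X Y id). Qed.

Lemma zspan_mul (R : pzRingType) (X Y Z : R -> Prop) :
  (forall u v, X u -> Y v -> zspan Z (u * v)) ->
  forall u v, zspan X u -> zspan Y v -> zspan Z (u * v).
Proof.
move=> XYZ u v Xu Yv; move: u Xu.
apply: (@zspan_map _ _ X Z (fun u => u * v)) => [u w|u Xu]; first exact: mulrBl.
move: v Yv; apply: (@zspan_map _ _ Y Z (fun v => u * v)) => [v w|v Yv].
  exact: mulrBr.
exact: XYZ.
Qed.

Section Disjoint.
Variable I : finType.
Implicit Types A B D : {set I}.

Lemma disjointUl A B D :
  [disjoint A :|: B & D] = [disjoint A & D] && [disjoint B & D].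
Proof. by rewrite !finset.disjoints_subset finset.subUset. Qed.

Lemma disjointUr A B D :
  [disjoint D & A :|: B] = [disjoint D & A] && [disjoint D & B].
Proof. by rewrite ![[disjoint D & _]]disjoint_sym disjointUl. Qed.

End Disjoint.

Section Words.
Variables (I : finType) (R : comPzRingType).
Implicit Types (h : {set I} -> nat -> nat -> R) (M : seq ({set I} * nat)).

(** The sum over [D > d_1 > ... > d_r >= 0] of the products of the letters
[h U_j n_j d_j], where the [(U_j, n_j)] are the entries of [M]. *)
Fixpoint wsum h M (D : nat) : R :=
  if M is c :: M' then \sum_(d < D) h c.1 c.2 d * wsum h M' d else 1.

(** Counting the occurrences of each index says at once that the sets in [M] are
disjoint and that their union is [U]. *)
Definition wtype M (U : {set I}) (n : nat) : Prop :=
  [/\ all (fun c => 0 < c.2)%N M,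
      forall k, (\sum_(c <- M) (k \in c.1 : nat))%N = (k \in U)
    & (\sum_(c <- M) c.2)%N = n].

Lemma wtype_nil U n : wtype [::] U n -> U = finset.set0 /\ n = 0%N.
Proof.
case=> _ HU Hn; split; last by rewrite -Hn big_nil.
by apply/setP => k; rewrite inE; have := HU k; rewrite big_nil; case: (k \in U).
Qed.

Lemma wtype_cons c M U n : wtype (c :: M) U n ->
  exists (V : {set I}) m, [/\ [disjoint c.1 & V], c.1 :|: V = U, (0 < c.2)%N,
                 (c.2 + m)%N = n & wtype M V m].
Proof.
case=> /= /andP[c0 M0] HU Hn.
exists (U :\: c.1), (\sum_(c <- M) c.2)%N; split => //.
- by rewrite -finset.setI_eq0; apply/eqP/setP => k; rewrite !inE; case: (k \in c.1).
- apply/setP => k; rewrite !inE; have := HU k; rewrite big_cons.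
  by case: (k \in c.1); case: (k \in U).
- by rewrite -Hn big_cons.
split=> // k; have := HU k; rewrite big_cons !inE.
by case: (k \in c.1); case: (k \in U) => //=; rewrite add1n => -[].
Qed.

Lemma cons_wtype (U V : {set I}) k m M : [disjoint U & V] -> (0 < k)%N ->
  wtype M V m -> wtype ((U, k) :: M) (U :|: V) (k + m).
Proof.
move=> dUV k0 [M0 HV Hm]; split=> /=; first by rewrite k0.
  move=> x; rewrite big_cons HV inE /=.
  have := disjointFr dUV (x := x).
  by case: (x \in U) => // /(_ isT) ->.
by rewrite big_cons Hm.
Qed.

Definition words h U n : (nat -> R) -> Prop :=
  zspan (fun u => exists2 M, wtype M U n & (u = wsum h M)).

(** The outer index of summation is kept free, so that two such sequences can be
multiplied termwise; their partial sums lie in [words]. *)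
Definition heads h U n : (nat -> R) -> Prop :=
  zspan (fun u => exists (W : {set I}) k (V : {set I}) m v,
    [/\ [disjoint W & V], W :|: V = U, (0 < k)%N, (k + m)%N = n
      & words h V m v /\ u = h W k * v]).

Definition psum (u : nat -> R) (D : nat) : R := \sum_(d < D) u d.

Lemma psumB : {morph psum : u v / u - v}.
Proof. by move=> u v; apply/funext => D; exact: sumrB. Qed.

Lemma words1 h : words h finset.set0 0 1.
Proof.
apply: zspan_in; exists [::] => //; split=> // [k|]; rewrite ?big_nil //.
by rewrite inE.
Qed.

Lemma words_cons h (U V : {set I}) k m u :
  [disjoint U & V] -> (0 < k)%N -> words h V m u ->
  words h (U :|: V) (k + m) (psum (h U k * u)).
Proof.
move=> dUV k0; move: u; apply: (zspan_map (f := fun u => psum (h U k * u))).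
  by move=> u v; rewrite mulrBr psumB.
move=> u [M HM ->]; apply: zspan_in; exists ((U, k) :: M) => //.
exact: cons_wtype.
Qed.

Lemma psum_heads h U n u : heads h U n u -> words h U n (psum u).
Proof.
move: u; apply: (zspan_map psumB) => u [W [k [V [m [v [dWV <- k0 <- [Vv ->]]]]]]].
exact: words_cons.
Qed.

Lemma heads_in h (W V : {set I}) k m v : [disjoint W & V] -> (0 < k)%N ->
  words h V m v -> heads h (W :|: V) (k + m) (h W k * v).
Proof. by move=> *; apply: zspan_in; exists W, k, V, m, v. Qed.

Lemma heads1 h U n : (0 < n)%N -> heads h U n (h U n).
Proof.
move=> n0; have := @heads_in h U finset.set0 n 0 1 _ n0 (words1 h).
rewrite finset.setU0 addn0 mulr1; apply.
by rewrite disjoint_sym finset.disjoints_subset finset.sub0set.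
Qed.

(** The bound on the weight makes room for an induction: the product of two words
uses products of smaller weight only. *)
Definition words_closed h N := forall (U V : {set I}) n m u v, (n + m < N)%N ->
  [disjoint U & V] ->
  words h U n u -> words h V m v -> words h (U :|: V) (n + m) (u * v).

Lemma heads_mul_lt h N (U V : {set I}) n m u v :
  words_closed h N -> (n + m <= N)%N ->
  [disjoint U & V] -> heads h U n u -> words h V m v ->
  heads h (U :|: V) (n + m) (u * v).
Proof.
move=> hN nmN dUV Hu Hv; move: u Hu.
apply: (zspan_map (f := fun u => u * v)) => [u w|u]; first exact: mulrBl.
move=> [W [k [V' [m' [w [dWV defU k0 defn [Vw ->]]]]]]].
rewrite -defU -finset.setUA -defn -addnA -mulrA.
move: dUV; rewrite -defU disjointUl => /andP[dW dV'].
apply: heads_in => //.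
  by rewrite disjointUr dWV.
apply: hN => //; apply: leq_trans nmN; rewrite -defn; lia.
Qed.

(** The quasi-shuffle product: the product of two iterated sums splits
according to which of the two outer indices is larger, or whether they agree;
in the last case the product of the two outer letters is expanded again. *)
Lemma words_mul_lt h :
  (forall (U V : {set I}) n m, [disjoint U & V] -> (0 < n)%N -> (0 < m)%N ->
     heads h (U :|: V) (n + m) (h U n * h V m)) ->
  forall N, words_closed h N.
Proof.
move=> hh; elim=> [//|N IH] U V n m u v ltN dUV; move: u v.
apply: zspan_mul => u v [M1 H1 ->] [M2 H2 ->].
case: M1 H1 => [|c1 M1] H1.
  have [-> ->] := wtype_nil H1; rewrite finset.set0U add0n (_ : wsum h [::] = 1) // mul1r.
  by apply: zspan_in; exists M2.
case: M2 H2 => [|c2 M2] H2.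
  have [-> ->] := wtype_nil H2; rewrite finset.setU0 addn0 (_ : wsum h [::] = 1) // mulr1.
  by apply: zspan_in; exists (c1 :: M1).
have [U' [n' [dU defU c10 defn HM1]]] := wtype_cons H1.
have [V' [m' [dV defV c20 defm HM2]]] := wtype_cons H2.
set u1 := wsum h (c1 :: M1); set u2 := wsum h (c2 :: M2).
have -> : u1 * u2 = psum (h c1.1 c1.2 * wsum h M1 * u2
                         + h c2.1 c2.2 * wsum h M2 * u1
                         + h c1.1 c1.2 * h c2.1 c2.2 * (wsum h M1 * wsum h M2)).
  apply/funext => D; rewrite /u1 /u2 /psum.
  elim: D => [|D IHD].
    by rewrite mulrfctE /= !big_ord0 mul0r.
  rewrite big_ord_recr /= -IHD !(mulrfctE, addrfctE) /= !big_ord_recr /=.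
  set a := \sum_(i < D) _; set b := \sum_(i < D) _.
  by ring.
have Wu1 : words h U n u1 by apply: zspan_in; exists (c1 :: M1).
have Wu2 : words h V m u2 by apply: zspan_in; exists (c2 :: M2).
have WM1 : words h U' n' (wsum h M1) by apply: zspan_in; exists M1.
have WM2 : words h V' m' (wsum h M2) by apply: zspan_in; exists M2.
move: (dUV); rewrite -{1}defU -{1}defV disjointUl !disjointUr.
case/andP=> /andP[d1 d2] /andP[d3 d4].
have leN : (n + m <= N)%N by [].
apply: psum_heads; apply: zspanD; first apply: zspanD.
- apply: (heads_mul_lt IH leN dUV) Wu2.
  by rewrite -defU -defn; apply: heads_in.
- rewrite finset.setUC addnC; apply: (heads_mul_lt IH) => //.
  + by rewrite addnC.
  + by rewrite disjoint_sym.
  + by rewrite -defV -defm; apply: heads_in.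
- have -> : U :|: V = (c1.1 :|: c2.1) :|: (U' :|: V').
    by rewrite -defU -defV finset.setUACA.
  have -> : (n + m = (c1.2 + c2.2) + (n' + m'))%N by lia.
  apply: (heads_mul_lt IH).
  + lia.
  + by rewrite disjointUl !disjointUr dU d2 dV disjoint_sym d3.
  + exact: hh.
  + by apply: IH => //; lia.
Qed.

Definition mul_closed h := forall N, words_closed h N.

Lemma words_mul h (U V : {set I}) n m u v : mul_closed h -> [disjoint U & V] ->
  words h U n u -> words h V m v -> words h (U :|: V) (n + m) (u * v).
Proof. by move=> hc; apply: (hc (n + m).+1). Qed.

Lemma heads_mul h (U V : {set I}) n m u v : mul_closed h -> [disjoint U & V] ->
  heads h U n u -> words h V m v -> heads h (U :|: V) (n + m) (u * v).
Proof. by move=> hc; apply: (heads_mul_lt (hc (n + m).+1)). Qed.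

(** A letter [h] is turned into a letter [h'] times a word, and this word is
multiplied with what the rest of the word has become. The bound [N] allows this
to be used inside an induction on the weight. *)
Lemma words_transfer h h' N : mul_closed h' ->
  (forall U n, (0 < n <= N)%N -> heads h' U n (h U n)) ->
  forall U n u, (n <= N)%N -> words h U n u -> words h' U n u.
Proof.
move=> hc hh U n u nN; apply: zspan_sub => {}u [M HM ->].
elim: M U n nN HM => [|c M IH] U n nN HM.
  have [-> ->] := wtype_nil HM; exact: words1.
have [V [m [dV <- c0 defn HM']]] := wtype_cons HM.
rewrite -defn (_ : wsum h _ = psum (h c.1 c.2 * wsum h M)) //.
apply: psum_heads; apply: heads_mul => //; first by apply: hh; lia.
by apply: IH => //; lia.
Qed.

End Words.

(** * Sums over monic polynomials *)

Section Monics.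
Variables (F : finFieldType) (V : zmodType).
Implicit Types (d D : nat) (g : {poly F} -> V).

Definition monicsum d g : V :=
  \sum_(a : {poly_d.+1 F} | ((a : {poly F}) \is monic) && (size a == d.+1)) g a.

Lemma npoly_inj d (a b : {poly_d F}) : a = b :> {poly F} -> a = b.
Proof. exact: val_inj. Qed.

Lemma sum_npoly_widen d D (P : pred {poly F}) g : (d <= D)%N ->
  (forall a, P a -> (size a <= d)%N) ->
  \sum_(a : {poly_D F} | P a) g a = \sum_(a : {poly_d F} | P a) g a.
Proof.
move=> dD Pd.
rewrite (reindex_onto (fun a : {poly_d F} => npolyp D a)
                      (fun a : {poly_D F} => npolyp d a)); last first.
  by move=> a Pa; apply: npoly_inj; cbv beta; rewrite npolypK npolypK ?Pd ?size_npoly.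
have K (a : {poly_d F}) : npolyp D a = a :> {poly F}.
  by rewrite npolypK // (leq_trans (size_npoly a)).
apply: eq_big => [a|a _]; last by rewrite K.
rewrite K -[in RHS](andbT (P _)); congr (_ && _).
by apply/eqP/npoly_inj; cbv beta; rewrite npolypK // size_npoly.
Qed.

Lemma monicsum_widen d D g : (d < D)%N ->
  \sum_(a : {poly_D F} | ((a : {poly F}) \is monic) && (size a == d.+1)) g a
  = monicsum d g.
Proof.
move=> dD; rewrite (@sum_npoly_widen d.+1 D (fun a => (a \is monic) && (size a == d.+1))) //.
by move=> a /andP[_ /eqP->].
Qed.

Lemma monic_shift d (c : {poly F}) : (size c <= d)%N ->
  ('X^d + c \is monic) && (size ('X^d + c) == d.+1).
Proof.
move=> sc; rewrite size_polyDl ?size_polyXn // eqxx andbT.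
by rewrite monicE lead_coefDl ?size_polyXn // lead_coefXn.
Qed.

Lemma size_monic_sub d (a b : {poly F}) : a \is monic -> size a = d.+1 ->
  b \is monic -> size b = d.+1 -> (size (a - b)%R <= d)%N.
Proof.
move=> ma sa mb sb; apply/leq_sizeP => j dj; rewrite coefB.
have [->|jd] := eqVneq j d.
  have -> : a`_d = 1 by rewrite -(monicP ma) lead_coefE sa.
  by have -> : b`_d = 1; [rewrite -(monicP mb) lead_coefE sb | rewrite subrr].
by rewrite !nth_default ?subrr // ?sa ?sb; lia.
Qed.

Lemma monicsum_translate d (a : {poly F}) g : a \is monic -> size a = d.+1 ->
  monicsum d g = \sum_(c : {poly_d F}) g (a + c).
Proof.
move=> ma sa; rewrite /monicsum.
rewrite (reindex_onto (fun c : {poly_d F} => npolyp d.+1 (a + c))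
                      (fun b : {poly_d.+1 F} => npolyp d ((b : {poly F}) - a))).
  have K (c : {poly_d F}) : npolyp d.+1 (a + c) = a + c :> {poly F}.
    rewrite npolypK // (leq_trans (size_polyD _ _)) // geq_max sa leqnn /=.
    exact: leqW (size_npoly c).
  apply: eq_big => [c|c _]; last by rewrite K.
  rewrite K; apply/andP; split.
    have sc : (size (c : {poly F}) < size a)%N by rewrite sa ltnS size_npoly.
    rewrite size_polyDl // sa eqxx andbT.
    by rewrite monicE lead_coefDl // -monicE.
  by apply/eqP/npoly_inj; cbv beta; rewrite addrC addKr npolypK // size_npoly.
move=> b /andP[mb /eqP sb].
have E : npolyp d ((b : {poly F}) - a) = (b : {poly F}) - a :> {poly F}.
  by rewrite npolypK // (size_monic_sub mb sb).
have abE : a + ((b : {poly F}) - a) = b by rewrite addrC subrK.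
by apply: npoly_inj; rewrite npolypK E abE // size_npoly.
Qed.

Lemma monicsumE d g : monicsum d g = \sum_(c : {poly_d F}) g ('X^d + c).
Proof. by rewrite (@monicsum_translate d 'X^d) ?monicXn ?size_polyXn. Qed.

Lemma sum_npoly_monic D g :
  \sum_(c : {poly_D F} | (c : {poly F}) \is monic) g c = \sum_(d < D) monicsum d g.
Proof.
transitivity (\sum_(c : {poly_D F} | (c : {poly F}) \is monic)
   \sum_(d < D | size c == d.+1) g c).
  apply: eq_bigr => c mc.
  have c0 : (0 < size c)%N by rewrite size_poly_gt0 monic_neq0.
  have sD : ((size c).-1 < D)%N by rewrite prednK // size_npoly.
  rewrite (big_pred1 (Ordinal sD)) // => i.
  by rewrite /pred1 /= -[in LHS](prednK c0) eqSS eq_sym.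
rewrite (exchange_big_dep predT) //=; apply: eq_bigr => d _.
by rewrite -(monicsum_widen g (ltn_ord d)).
Qed.

Lemma sum_npoly_neq0 D g :
  \sum_(c : {poly_D F} | c != 0) g c =
  \sum_(lam : F | lam != 0) \sum_(d < D) monicsum d (fun c => g (lam *: c)).
Proof.
rewrite (partition_big (fun c : {poly_D F} => lead_coef c) (fun lam => lam != 0)).
  apply: eq_bigr => lam lam0; rewrite -sum_npoly_monic.
  rewrite (reindex_onto (fun c : {poly_D F} => lam *: c)
                        (fun c : {poly_D F} => lam^-1 *: c)).
    apply: eq_bigl => c; rewrite scalerA mulVf // scale1r eqxx andbT.
    rewrite lead_coefZ; apply/andP/idP => [[_ /eqP lc]|mc].
      by rewrite monicE; apply/eqP/(mulfI lam0); rewrite mulr1.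
    rewrite (monicP mc) mulr1 eqxx scaler_eq0 negb_or lam0; split=> //=.
    by apply: contraTneq mc => ->; rewrite monicE lead_coef0 eq_sym oner_eq0.
  by move=> c _; rewrite scalerA divff // scale1r.
by move=> c c0; rewrite lead_coef_eq0; apply: contra c0 => /eqP c0; apply/eqP/npoly_inj.
Qed.

Lemma monicsum_sum I (r : seq I) (P : pred I) d (g : I -> {poly F} -> V) :
  monicsum d (fun a => \sum_(i <- r | P i) g i a) =
  \sum_(i <- r | P i) monicsum d (g i).
Proof. exact: exchange_big. Qed.

Lemma monicsumB d g1 g2 : monicsum d (fun a => g1 a - g2 a) = monicsum d g1 - monicsum d g2.
Proof. exact: sumrB. Qed.

Lemma eq_monicsum d g1 g2 :
  (forall a, a \is monic -> size a = d.+1 -> g1 a = g2 a) -> monicsum d g1 = monicsum d g2.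
Proof. by move=> eqg; apply: eq_bigr => a /andP[ma /eqP]; exact: eqg. Qed.

(** Two distinct monic polynomials of the same degree differ by a scalar times
a monic polynomial of smaller degree. *)
Lemma monicsum_pair d (g : {poly F} -> {poly F} -> V) :
  monicsum d (fun a => monicsum d (g a)) = monicsum d (fun a => g a a) +
  monicsum d (fun a => \sum_(lam : F | lam != 0)
    \sum_(d' < d) monicsum d' (fun c => g a (a + lam *: c))).
Proof.
rewrite /monicsum -big_split /=; apply: eq_bigr => a /andP[ma /eqP sa].
rewrite -/(monicsum d (g a)) (monicsum_translate _ ma sa) (bigD1 0) //= addr0.
by congr (_ + _); rewrite (sum_npoly_neq0 _ (fun c => g a ((a : {poly F}) + c))).
Qed.

End Monics.

(** * Products of letters *)

Lemma natmul_app (X : Type) (V : zmodType) (u : X -> V) n x : (u *+ n) x = u x *+ n.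
Proof. by elim: n => // n IH; rewrite !mulrS -IH. Qed.

Lemma sum_app (X : Type) (V : zmodType) I (r : seq I) (P : pred I) (f : I -> X -> V) x :
  (\sum_(i <- r | P i) f i) x = \sum_(i <- r | P i) f i x.
Proof. by elim/big_rec2: _ => // i u v _ <-. Qed.

Lemma sign_app (X Y : Type) (R : pzRingType) (u : X -> Y -> R) r x y :
  ((-1) ^+ r * u) x y = (-1) ^+ r * u x y.
Proof.
elim: r => [|r IH]; first by rewrite !expr0 !mul1r.
by rewrite !exprS -!mulrA !mulN1r -IH.
Qed.

Lemma exprNV (C : fieldType) (x : C) r : (- x) ^- r = (-1) ^+ r * x ^- r.
Proof. by rewrite -!exprVn invrN -[- x^-1]mulN1r exprMn. Qed.

Lemma prodr_setU (R : comPzRingType) (I : finType) (A B : {set I}) (x : I -> R) :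
  [disjoint A & B] ->
  \prod_(k in A :|: B) x k = \prod_(k in A) x k * \prod_(k in B) x k.
Proof.
by move=> dAB; rewrite -bigU //; apply: eq_bigl => k; rewrite finset.in_setU.
Qed.

Lemma prodrD_in (R : comPzRingType) (I : finType) (V : {set I}) (x y : I -> R) :
  \prod_(k in V) (x k + y k) =
  \sum_(W : {set I} | W \subset V) (\prod_(k in V :\: W) x k * \prod_(k in W) y k).
Proof.
rewrite big_mkcond /=.
transitivity (\prod_k ((if k \in V then y k else 0) + (if k \in V then x k else 1))).
  by apply: eq_bigr => k _; case: ifP; rewrite ?add0r // addrC.
rewrite bigA_distr (bigID (fun W : {set I} => W \subset V)) /=.
rewrite [X in _ + X]big1 ?addr0 => [|W /fintype.subsetPn[k kW kV]]; last first.
  by rewrite (bigD1 k) //= kW (negbTE kV) mul0r.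
apply: eq_bigr => W WV.
rewrite [X in _ = X * _]big_mkcond [X in _ = _ * X]big_mkcond -big_split.
apply: eq_bigr => k _; rewrite inE; case: (boolP (k \in W)) => /= kW.
  by rewrite (fintype.subsetP WV _ kW) mul1r.
by case: ifP; rewrite mulr1.
Qed.

(** A character of the group of units adds up to 0 or to the order of the group.
In both cases the sum lies in the prime field, which is why the coefficients in
the product of two letters do. *)
Lemma sum_units_nat (F : finFieldType) (chi : F -> F) :
  {morph chi : x y / x * y} ->
  exists n : nat, \sum_(x : F | x != 0) chi x = n%:R.
Proof.
move=> chiM; case: (boolP [forall x : F, (x != 0) ==> (chi x == 1)]).
  move=> /forallP chi1; exists #|[pred x : F | x != 0]|.
  by rewrite (eq_bigr (fun=> 1)) ?sumr_const // => x x0; apply/eqP/(implyP (chi1 x)).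
rewrite negb_forall => /existsP[y]; rewrite negb_imply => /andP[y0 cy]; exists 0%N.
have : \sum_(x : F | x != 0) chi x = chi y * \sum_(x : F | x != 0) chi x.
  rewrite mulr_sumr (reindex_onto (fun x => y * x) (fun x => y^-1 * x)) /=.
    apply: eq_big => [x|x _]; last by rewrite chiM.
    by rewrite mulKf // eqxx andbT mulf_eq0 (negbTE y0).
  by move=> x _; rewrite mulVKf.
move/eqP; rewrite -subr_eq0 -{1}[\sum_(x | _) _]mul1r -mulrBl mulf_eq0 subr_eq0.
by rewrite eq_sym (negbTE cy) /= => /eqP.
Qed.

Section Letters.
Variables (F : finFieldType) (C : fieldType) (inF : {rmorphism F -> C}) (theta : C).
Hypothesis th_transc : forall a : {poly F}, ev inF a theta = 0 -> a = 0.
Variables (I : finType) (T : Type).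

Local Notation "a %:th" := (ev inF a theta) (at level 2, format "a %:th").

Lemma evB (a b : {poly F}) x : ev inF (a - b) x = ev inF a x - ev inF b x.
Proof. by rewrite /ev rmorphB hornerD hornerN. Qed.

Lemma evN (a : {poly F}) x : ev inF (- a) x = - ev inF a x.
Proof. by rewrite /ev rmorphN hornerN. Qed.

Lemma evD (a b : {poly F}) x : ev inF (a + b) x = ev inF a x + ev inF b x.
Proof. by rewrite /ev rmorphD hornerD. Qed.

Lemma evZ lam (a : {poly F}) x : ev inF (lam *: a) x = inF lam * ev inF a x.
Proof. by rewrite /ev map_polyZ hornerZ. Qed.

Lemma ev_monic_neq0 a : a \is monic -> a%:th != 0.
Proof. by apply: contraTneq => /th_transc->; rewrite monicE lead_coef0 eq_sym oner_eq0. Qed.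

(** The two systems of letters differ in the factor [f k a t] only: it is either
the value of [a] at a point, or it depends on the degree of [a] alone. *)
Definition letter (f : I -> {poly F} -> T -> C) (U : {set I}) (n d : nat) (t : T) : C :=
  monicsum d (fun a => a%:th ^- n * \prod_(k in U) f k a t).

Section Product.
Variables (f : I -> {poly F} -> T -> C) (eps : bool).
(* [eps] tells an additive factor from one that ignores lower order terms. *)
Hypothesis f_shift : forall k t a c lam, a \is monic -> c \is monic ->
  (size c < size a)%N -> f k (a + lam *: c) t = f k a t + eps%:R * inF lam * f k c t.

(* The factor [(a - b) ^- r] makes the family stable under partial fractions. *)
Let offdiag (U V : {set I}) n m r d t : C :=
  monicsum d (fun a => monicsum d (fun b => if a == b then 0 else
    a%:th ^- n * b%:th ^- m * (a - b)%:th ^- r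
    * ((\prod_(k in U) f k a t) * \prod_(k in V) f k b t))).

Let offdiag_sym U V n m r : offdiag U V n m r = (-1) ^+ r * offdiag V U m n r.
Proof.
apply/funext => d; apply/funext => t.
rewrite sign_app /offdiag {1 2}/monicsum exchange_big /= [X in _ * X]/monicsum mulr_sumr.
apply: eq_bigr => b _; rewrite /monicsum mulr_sumr; apply: eq_bigr => a _.
rewrite eq_sym; case: eqP => [_|_]; first by rewrite mulr0.
rewrite -(opprB (b : {poly F})) evN exprNV.
by rewrite [a%:th ^- _ * _]mulrC [(\prod_(k in U) _) * _]mulrC; ring.
Qed.

(** This is the identity [1 / (a b) = (1 / b - 1 / a) / (a - b)]. *)
Let offdiag_rec U V n m r :
  offdiag U V n.+1 m.+1 r = offdiag U V n m.+1 r.+1 - offdiag U V n.+1 m r.+1.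
Proof.
apply/funext => d; apply/funext => t.
rewrite -[RHS]/(offdiag U V n m.+1 r.+1 d t - offdiag U V n.+1 m r.+1 d t).
rewrite -monicsumB; apply: eq_monicsum => a ma _; rewrite -monicsumB.
apply: eq_monicsum => b mb _; case: eqP => [_|/eqP ab]; first by rewrite subr0.
rewrite -mulrBl; congr (_ * _).
have a0 := ev_monic_neq0 ma.
have b0 := ev_monic_neq0 mb.
have c0 : (a - b)%:th != 0.
  by apply: contra ab => /eqP /th_transc /eqP; rewrite subr_eq0.
rewrite !exprS !invfM; rewrite evB in c0 *.
move: (a%:th ^- n) (b%:th ^- m) (_ ^- r) => x y z.
by field; rewrite a0 b0 c0.
Qed.

(** Write [b = a + lam c] with [c] monic of smaller degree. The product over [V]
expands over the sets [W] of variables at which the term in [c] is chosen, and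
the powers of [lam] add up to an element of the prime field. *)
Let offdiag_base (U V : {set I}) n r : [disjoint U & V] -> (0 < n)%N -> (0 < r)%N ->
  heads (letter f) (U :|: V) (n + r) (offdiag U V n 0 r).
Proof.
move=> dUV n0 r0.
have E (W : {set I}) : exists nu : nat,
    \sum_(lam : F | lam != 0) eps%:R ^+ #|W| * inF (lam ^+ #|W| * lam ^- r) = nu%:R.
  have [nu Hnu] := @sum_units_nat F (fun x => x ^+ #|W| * x ^- r)
    (fun x y => ltac:(by rewrite /= !exprMn invfM; ring)).
  exists (eps ^ #|W| * nu)%N; rewrite -mulr_sumr -rmorph_sum Hnu rmorph_nat.
  by rewrite natrM natrX.
have [nu nuP] := boolp.choice E.
have -> : offdiag U V n 0 r = \sum_(W : {set I} | W \subset V)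
    (-1) ^+ r * (letter f (U :|: V :\: W) n * wsum (letter f) [:: (W, r)]) *+ nu W.
  apply/funext => d; apply/funext => t; rewrite !sum_app.
  transitivity (\sum_(W : {set I} | W \subset V)
      ((-1) ^+ r * (letter f (U :|: V :\: W) n d t *
         \sum_(d' < d) letter f W r d' t)) *+ nu W); last first.
    apply: eq_bigr => W _; rewrite !natmul_app; congr (_ *+ _).
    rewrite sign_app; congr (_ * (_ * _)); rewrite /= sum_app; apply: eq_bigr => i _.
    by rewrite -[RHS]/(_ * 1) mulr1.
  rewrite /offdiag monicsum_pair [X in X + _]big1 ?add0r => [|a _]; last by rewrite eqxx.
  transitivity (monicsum d (fun a => \sum_(W : {set I} | W \subset V)
     \sum_(lam : F | lam != 0) \sum_(d' < d) monicsum d' (fun c =>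
      ((-1) ^+ r * (eps%:R ^+ #|W| * inF (lam ^+ #|W| * lam ^- r))) *
      ((a%:th ^- n * \prod_(k in U :|: V :\: W) f k a t) *
       (c%:th ^- r * \prod_(k in W) f k c t))))).
    apply: eq_monicsum => a ma sa; rewrite [RHS]exchange_big /=; apply: eq_bigr => lam lam0.
    rewrite [RHS]exchange_big /=; apply: eq_bigr => -[d' /= ltd' _].
    rewrite -monicsum_sum; apply: eq_monicsum => c mc sc.
    have c0 := ev_monic_neq0 mc.
    have il0 : inF lam != 0 by rewrite fmorph_eq0.
    rewrite -[X in X == _]addr0 (inj_eq (addrI a)) eq_sym scaler_eq0 (negbTE lam0) /=.
    rewrite (negbTE (monic_neq0 mc)) expr0 invr1 mulr1.
    rewrite opprD addNKr.
    under [X in _ * (_ * X)]eq_bigr do rewrite f_shift ?sa ?sc //.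
    rewrite prodrD_in !mulr_sumr; apply: eq_bigr => W WV.
    rewrite big_split /= prodr_const prodr_setU /=; last first.
      by apply: disjointWr dUV; exact: finset.subsetDl.
    rewrite evN evZ exprNV rmorphM fmorphV !rmorphXn !exprMn invfM.
    by ring.
  rewrite monicsum_sum; apply: eq_bigr => W WV.
  rewrite -[RHS]mulr_natr -(nuP W).
  set B := \sum_(d' < d) letter f W r d' t.
  transitivity (monicsum d (fun a =>
    (\sum_(lam : F | lam != 0)
       (-1) ^+ r * (eps%:R ^+ #|W| * inF (lam ^+ #|W| * lam ^- r))) *
    ((a%:th ^- n * \prod_(k in U :|: V :\: W) f k a t) * B))).
    apply: eq_monicsum => a _ _; rewrite mulr_suml; apply: eq_bigr => lam _.
    rewrite !mulr_sumr; apply: eq_bigr => d' _.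
    by rewrite /letter /monicsum !mulr_sumr.
  rewrite -mulr_sumr /monicsum -mulr_sumr -mulr_suml -/(monicsum _ _).
  by rewrite [RHS]mulrAC.
apply: zspan_sum => W WV; apply: zspanMn.
have WVC : V :\: W :|: W = V by rewrite finset.setUC finset.setDE finset.setUIr
  finset.setUCr finset.setIT; apply/finset.setUidPr.
have : heads (letter f) (U :|: V) (n + r)
    (letter f (U :|: V :\: W) n * wsum (letter f) [:: (W, r)]).
  rewrite -[in X in heads _ X]WVC finset.setUA; apply: heads_in => //.
    rewrite disjointUl (disjointWr WV dUV) /=.
    by rewrite finset.disjoints_subset finset.setDE finset.subsetIr.
  apply: zspan_in; exists [:: (W, r)] => //.
  rewrite -[W in wtype _ W]finset.setU0 -[X in wtype _ _ X]addn0.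
  apply: cons_wtype => //.
    by rewrite disjoint_sym finset.disjoints_subset finset.sub0set.
  by split=> // [k|]; rewrite big_nil ?finset.inE.
rewrite -signr_odd; case: odd => Hh; rewrite ?expr0 ?mul1r // expr1 mulN1r.
exact: zspanN.
Qed.

(** The terms with [a = b] form the letter of weight [n + m]. In the other terms,
partial fractions move the exponents to [a - b], until [a] or [b] has left the
denominator. *)
Lemma letter_mul (U V : {set I}) n m : [disjoint U & V] -> (0 < n)%N -> (0 < m)%N ->
  heads (letter f) (U :|: V) (n + m) (letter f U n * letter f V m).
Proof.
move=> dUV n0 m0.
have base (A B : {set I}) k r : [disjoint A & B] -> (0 < k)%N -> (0 < r)%N ->
    heads (letter f) (A :|: B) (k + r) (offdiag A B 0 k r).
  move=> dAB k0 r0; rewrite offdiag_sym.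
  have := @offdiag_base B A k r; rewrite disjoint_sym finset.setUC => /(_ dAB k0 r0).
  rewrite -signr_odd; case: odd => Hh; rewrite ?expr0 ?mul1r // expr1 mulN1r.
  exact: zspanN.
have gen s : forall k l r, (k + l = s)%N -> (0 < k + l)%N ->
    ((0 < k) && (0 < l) || (0 < r))%N ->
    heads (letter f) (U :|: V) (k + l + r) (offdiag U V k l r).
  elim: s => [k l r -> //|s IH] [|k] [|l] r // kls kl0 H.
  - by rewrite add0n; apply: base.
  - by rewrite addn0; apply: offdiag_base.
  - rewrite offdiag_rec; apply: zspanB.
      have -> : (k.+1 + l.+1 + r = k + l.+1 + r.+1)%N by lia.
      by apply: IH => //; [lia | lia | rewrite orbT].
    have -> : (k.+1 + l.+1 + r = k.+1 + l + r.+1)%N by lia.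
    by apply: IH => //; [lia | rewrite orbT].
have -> : letter f U n * letter f V m = letter f (U :|: V) (n + m) + offdiag U V n m 0.
  apply/funext => d; apply/funext => t.
  rewrite -[LHS]/(letter f U n d t * letter f V m d t).
  rewrite -[RHS]/(letter f (U :|: V) (n + m) d t + offdiag U V n m 0 d t).
  rewrite [in LHS]/letter [X in X * _]/monicsum mulr_suml.
  rewrite /letter /offdiag /monicsum -big_split /=; apply: eq_bigr => a Ha.
  rewrite mulr_sumr (bigD1 a) //= [in RHS](bigD1 a) //= eqxx add0r.
  rewrite exprD invfM prodr_setU //=; congr (_ + _); first by ring.
  apply: eq_bigr => b /andP[_ ba].
  have /negbTE-> : (a : {poly F}) != b.
    by apply: contra ba => /eqP ab; apply/eqP/npoly_inj.
  by rewrite expr0 invr1; ring.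
apply: zspanD; first by apply: heads1; lia.
have := gen (n + m)%N n m 0%N erefl; rewrite addn0 n0 m0; apply=> //; lia.
Qed.

Lemma letter_closed : mul_closed (letter f).
Proof. by apply: words_mul_lt => U V n m; exact: letter_mul. Qed.

End Product.
End Letters.

(** * Polynomials with constant derivative *)

Section ConstantDerivative.
Variable C : fieldType.

Lemma deriv_prod (K : eqType) (s : seq K) (f : K -> {poly C}) : uniq s ->
  (\prod_(k <- s) f k)^`() =
  \sum_(k <- s) (f k)^`() * \prod_(l <- s | l != k) f l.
Proof.
elim: s => [|k0 s IH] /=; first by rewrite !big_nil derivC.
case/andP=> k0s us; rewrite !big_cons derivM IH // eqxx /=; congr (_ * _ + _).
  rewrite [in RHS]big_seq_cond [LHS]big_seq; apply: eq_bigl => l.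
  by case: (boolP (l \in s)) => //= ls; apply/esym; apply: contraNneq k0s => <-.
rewrite mulr_sumr !big_seq; apply: eq_bigr => k ks.
rewrite big_cons; case: eqP => [k0k|_]; last by rewrite mulrCA.
by rewrite k0k ks in k0s.
Qed.

Variables (K : finType) (r : K -> C) (P : {poly C}) (c : C).
Hypotheses (r_inj : injective r) (rP : forall k, root P (r k)).
Hypotheses (sizeP : size P = #|K|.+1) (derivP : P^`() = c%:P).

(* The cofactors of the roots; they add up to the derivative. *)
Let Q k := lead_coef P *: \prod_(l | l != k) ('X - (r l)%:P).

Let PE k : P = ('X - (r k)%:P) * Q k.
Proof.
have E : \prod_l ('X - (r l)%:P) = ('X - (r k)%:P) * \prod_(l | l != k) ('X - (r l)%:P).
  by rewrite (bigD1 k).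
rewrite /Q -scalerAr -E.
rewrite [LHS](@all_roots_prod_XsubC _ _ (map r (enum K))).
- by rewrite big_map big_enum.
- by rewrite size_map -cardE.
- by apply/allP => _ /mapP[k' _ ->].
- by rewrite uniq_rootsE map_inj_uniq ?enum_uniq.
Qed.

Let sumQ : \sum_k Q k = c%:P.
Proof.
rewrite -derivP {1}[P](@all_roots_prod_XsubC _ _ (map r (enum K))).
- rewrite big_map derivZ deriv_prod ?enum_uniq // scaler_sumr big_enum /=.
  apply: eq_bigr => k _; rewrite derivXsubC mul1r /Q big_enum_cond; congr (_ *: _).
- by rewrite size_map -cardE.
- by apply/allP => _ /mapP[k' _ ->].
- by rewrite uniq_rootsE map_inj_uniq ?enum_uniq.
Qed.

Let coefP k m : P`_m.+1 = (Q k)`_m - r k * (Q k)`_m.+1.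
Proof. by rewrite (PE k) mulrBl coefB coefXM coefCM. Qed.

Let coefP0 k : P`_0 = - (r k * (Q k)`_0).
Proof. by rewrite (PE k) mulrBl coefB coefXM coefCM sub0r. Qed.

Let sumQ_coef m : \sum_k (Q k)`_m = if m == 0%N then c else 0.
Proof. by rewrite -coef_sum sumQ coefC. Qed.

(** The logarithmic derivative of [P], evaluated at the origin. *)
Lemma sum_inv_roots : P`_0 = -1 -> \sum_k (r k)^-1 = c.
Proof.
move=> P0; have /= <- := sumQ_coef 0; apply: eq_bigr => k _.
have /eqP := coefP0 k; rewrite P0 eqr_opp eq_sym => /eqP E.
have rk : r k != 0.
  by apply/eqP => z; move/eqP: E; rewrite z mul0r eq_sym oner_eq0.
by apply: (mulfI rk); rewrite divff.
Qed.

(** The logarithmic derivative of [P], expanded at infinity: a constant divided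
by a polynomial of degree [#|K|] starts with the power [- #|K|] of the variable,
and the coefficients of the expansion are the power sums of the roots. *)
Lemma sum_roots_exp m : (m.+1 < #|K|)%N -> \sum_k r k ^+ m = 0.
Proof.
have QN k j : (j <= #|K|)%N ->
    (Q k)`_(#|K| - j) = \sum_(s < j) P`_(#|K| - s) * r k ^+ (j.-1 - s).
  elim: j => [_|j IH ltj].
    rewrite big_ord0 subn0 nth_default //.
    have Q0 : Q k != 0.
      by apply/eqP => Q0; have := sizeP; rewrite (PE k) Q0 mulr0 size_poly0.
    have := sizeP; rewrite (PE k) mulrC size_Mmonic ?monicXsubC // size_XsubC.
    by rewrite addn2 => -[->].
  have := coefP k (#|K| - j.+1); rewrite subnSK // IH 1?ltnW // => /eqP.
  rewrite eq_sym subr_eq => /eqP ->; rewrite big_ord_recr /= subnn expr0 mulr1 addrC.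
  congr (_ + _); rewrite mulr_sumr; apply: eq_bigr => s _.
  rewrite mulrCA -exprS; congr (_ * _ ^+ _); have := ltn_ord s; lia.
have [n] := ubnP m; elim: n m => // n IH m ltmn ltm.
have := sumQ_coef (#|K| - m.+1).
under eq_bigr do rewrite QN ?(ltnW ltm) //.
rewrite exchange_big /= big_ord_recl subn0 subn0.
rewrite -mulr_sumr [X in _ + X]big1 ?addr0 => [|s _].
  rewrite subn_eq0 leqNgt ltm /= => /eqP; rewrite mulf_eq0 => /orP[/eqP PN|/eqP //].
  have : lead_coef P = 0 by rewrite lead_coefE sizeP.
  by move/eqP; rewrite lead_coef_eq0 -size_poly_eq0 sizeP.
rewrite -mulr_sumr IH ?mulr0 //; rewrite ?lift0 -?[bump _ _]/(s.+1);  have := ltn_ord s; lia.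
Qed.

(** The logarithmic derivative of [P], expanded at the root 0: it has a simple
pole there, contributed by [k0], and the other roots contribute the power sums of
their inverses. As the derivative is constant, multiplying back by [P] gives a
recursion for the coefficients of [P]. *)
Lemma coef_sum_roots k0 m : r k0 = 0 ->
  P`_m.+2 = \sum_(s < m.+2) P`_s * \sum_(k | k != k0) r k ^- (m.+2 - s).
Proof.
move=> rk0; have := sumQ_coef m.+1; rewrite (bigD1 k0) //= => /eqP.
have := coefP k0 m.+1; rewrite rk0 mul0r subr0 => <-; rewrite addr_eq0 => /eqP->.
have Qk k n : k != k0 -> (Q k)`_n = - \sum_(s < n.+1) P`_s * r k ^- (n.+1 - s).
  move=> kk0; have rk : r k != 0 by rewrite -rk0 (inj_eq r_inj).
  elim: n => [|n IH].
    by rewrite big_ord1 (coefP0 k) mulNr opprK mulrAC expr1 divff // mul1r.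
  apply: (mulfI rk); have := coefP k n; rewrite IH => /eqP.
  rewrite eq_sym subr_eq addrC -subr_eq => /eqP <-.
  rewrite [in RHS]big_ord_recr /= subSnn expr1 mulrN mulrDr mulrCA divff // mulr1.
  rewrite opprD; congr (- _ - _); rewrite mulr_sumr; apply: eq_bigr => s _.
  rewrite mulrCA; congr (_ * _); have -> : (n.+2 - s = (n.+1 - s).+1)%N by case: s => s /=; lia.
  by rewrite exprS invfM mulVKf.
rewrite -sumrN; under [LHS]eq_bigr => k kk do rewrite (Qk _ _ kk) opprK.
by rewrite exchange_big /=; apply: eq_bigr => s _; rewrite mulr_sumr.
Qed.

End ConstantDerivative.

(** * Carlitz polynomials *)

Section CarlitzPolynomials.
Variables (F : finFieldType) (C : fieldType) (inF : {rmorphism F -> C}) (theta : C).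
Variables (p e : nat).
Hypotheses (pC : p \in [pchar C]) (e_gt0 : (0 < e)%N) (cardF : #|F| = (p ^ e)%N).
Hypothesis th_transc : forall a : {poly F}, ev inF a theta = 0 -> a = 0.

Local Notation q := #|F|.
Local Notation "a %:th" := (ev inF a theta) (at level 2, format "a %:th").

Lemma q_gt1 : (1 < q)%N.
Proof.
have p1 : (1 < p)%N by apply: prime_gt1; apply: (pcharf_prime pC).
by rewrite cardF -{1}(exp1n e) ltn_exp2r.
Qed.

Lemma natq0 : q%:R = 0 :> C.
Proof. by rewrite cardF natrX (pcharf0 pC) expr0n; case: e e_gt0. Qed.

Lemma frobD j (x y : C) : (x + y) ^+ (q ^ j) = x ^+ (q ^ j) + y ^+ (q ^ j).
Proof.
apply: exprDn_pchar; rewrite cardF -expnM pnatX (pnatE _ (pcharf_prime pC)) pC.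
by [].
Qed.

Lemma frobN j (x : C) : (- x) ^+ (q ^ j) = - x ^+ (q ^ j).
Proof.
apply/eqP; rewrite -subr_eq0 opprK -frobD addNr expr0n.
by rewrite expn_eq0 (gtn_eqF (ltnW q_gt1)).
Qed.

Lemma frobB j (x y : C) : (x - y) ^+ (q ^ j) = x ^+ (q ^ j) - y ^+ (q ^ j).
Proof. by rewrite frobD frobN. Qed.

Lemma frob_sum j I (r : seq I) (P : pred I) (f : I -> C) :
  (\sum_(i <- r | P i) f i) ^+ (q ^ j) = \sum_(i <- r | P i) f i ^+ (q ^ j).
Proof.
elim/big_rec2: _ => [|i u v _ <-]; last exact: frobD.
by rewrite expr0n expn_eq0 (gtn_eqF (ltnW q_gt1)).
Qed.

Lemma frobF j (lam : F) : lam ^+ (q ^ j) = lam.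
Proof. by elim: j => [|j IH]; rewrite ?expr1 // expnS exprM expf_card. Qed.

Lemma frobiter i j (x : C) : (x ^+ (q ^ i)) ^+ (q ^ j) = x ^+ (q ^ (i + j)).
Proof. by rewrite -exprM expnD. Qed.

Lemma ev_Xn n x : ev inF 'X^n x = x ^+ n.
Proof. by rewrite /ev map_polyXn hornerXn. Qed.

Lemma th_neq (m n : nat) : m != n -> theta ^+ m - theta ^+ n != 0.
Proof.
move=> mn; rewrite -!ev_Xn -evB; apply/eqP => /th_transc /eqP.
rewrite subr_eq0 => /eqP E; have := congr1 (fun u : {poly F} => size u) E.
by rewrite !size_polyXn => -[/eqP]; rewrite (negbTE mn).
Qed.

Lemma qX_neq i j : i != j -> (q ^ i)%N != (q ^ j)%N.
Proof. by rewrite eqn_exp2l // q_gt1. Qed.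

Lemma Dc_neq0 i : Dc F theta i != 0.
Proof.
apply/prodf_neq0 => j _; apply: th_neq; apply: qX_neq.
by rewrite neq_ltn ltn_ord orbT.
Qed.

Lemma DcS i :
  Dc F theta i.+1 = (theta ^+ (q ^ i.+1) - theta) * Dc F theta i ^+ q.
Proof.
rewrite /Dc big_ord_recl expn0 expr1; congr (_ * _).
rewrite -prodrXl; apply: eq_bigr => j _.
by rewrite -[X in _ = _ ^+ X](expn1 q) frobB !frobiter !addn1 lift0.
Qed.

Lemma lcS i : lc F theta i.+1 = lc F theta i * (theta - theta ^+ (q ^ i.+1)).
Proof. by rewrite /lc big_nat_recr. Qed.

(** The coefficient of [x ^+ (q ^ j)] in the polynomial [carlitz i], and also the
weight of the value at [theta ^+ (q ^ j)] in a coefficient of the map. *)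
Definition carlitz_coef i j : C := if (j <= i)%N
  then (Dc F theta j)^-1 * lc F theta (i - j) ^- (q ^ j) else 0.

Lemma carlitz_coef_frob i j :
  carlitz_coef i.+1 j.+1 * (theta ^+ (q ^ j.+1) - theta) = carlitz_coef i j ^+ q.
Proof.
rewrite /carlitz_coef ltnS; case: ifP => ji; last first.
  by rewrite mul0r expr0n (gtn_eqF (ltnW q_gt1)).
have t0 : theta ^+ (q ^ j.+1) - theta != 0.
  by rewrite -{2}[theta]expr1 -(expn0 q); apply/th_neq/qX_neq.
rewrite subSS DcS [RHS]exprMn !exprVn -exprM -expnSr invfM.
by rewrite [LHS]mulrC !mulrA divff // mul1r.
Qed.

Lemma carlitz_coef_step i j : (j <= i.+1)%N ->
  carlitz_coef i.+1 j * (theta ^+ (q ^ j) - theta ^+ (q ^ i.+1)) = carlitz_coef i j.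
Proof.
rewrite leq_eqVlt => /orP[/eqP->|ji].
  by rewrite subrr mulr0 /carlitz_coef ltnn.
rewrite /carlitz_coef (ltnW ji) -ltnS ji subSn // lcS exprMn frobB frobiter.
have -> : ((i - j).+1 + j = i.+1)%N by lia.
have t0 : theta ^+ (q ^ j) - theta ^+ (q ^ i.+1) != 0.
  by apply/th_neq/qX_neq; lia.
by rewrite invfM mulrA mulfVK.
Qed.

(** For [a] in [F_q[theta]], the coefficient of [X ^+ (q ^ i)] in the action of [a]
on [X] through the Carlitz module. *)
Definition carlitz i (x : C) : C := \sum_(j < i.+1) carlitz_coef i j * x ^+ (q ^ j).

(** Together with [carlitz_step] this gives the functional equations of [carlitz]
under multiplication by [theta], with or without a Frobenius. *)
Lemma carlitz_frob i x :
  \sum_(j < i.+2) carlitz_coef i.+1 j * (theta ^+ (q ^ j) - theta) * x ^+ (q ^ j)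
  = carlitz i x ^+ q.
Proof.
rewrite big_ord_recl expn0 expr1 subrr mulr0 mul0r add0r -[X in _ = _ ^+ X](expn1 q) frob_sum.
by apply: eq_bigr => j _; rewrite lift0 carlitz_coef_frob exprMn frobiter addn1 expn1.
Qed.

Lemma carlitz_step i x :
  \sum_(j < i.+2) carlitz_coef i.+1 j * (theta ^+ (q ^ j) - theta ^+ (q ^ i.+1)) * x ^+ (q ^ j)
  = carlitz i x.
Proof.
rewrite big_ord_recr /= subrr mulr0 mul0r addr0.
by apply: eq_bigr => j _; rewrite carlitz_coef_step // ltnW // ltnS.
Qed.

Lemma carlitz_theta i x : carlitz i.+1 (theta * x) = theta * carlitz i.+1 x + carlitz i x ^+ q.
Proof.
rewrite -(carlitz_frob i x) /carlitz mulr_sumr -big_split /=; apply: eq_bigr => j _.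
by rewrite exprMn; ring.
Qed.

Lemma carlitz_theta_step i x :
  carlitz i.+1 (theta * x) = theta ^+ (q ^ i.+1) * carlitz i.+1 x + carlitz i x.
Proof.
rewrite -(carlitz_step i x) /carlitz mulr_sumr -big_split /=; apply: eq_bigr => j _.
by rewrite exprMn; ring.
Qed.

Lemma carlitz_0 x : carlitz 0 x = x.
Proof.
by rewrite /carlitz big_ord1 /carlitz_coef /= /Dc /lc big_ord0 big_geq // !expr1 invr1 !mul1r.
Qed.

Lemma carlitzD i x y : carlitz i (x + y) = carlitz i x + carlitz i y.
Proof. by rewrite /carlitz -big_split /=; apply: eq_bigr => j _; rewrite frobD mulrDr. Qed.

Lemma carlitz_at0 i : carlitz i 0 = 0.
Proof.
by have /eqP := carlitzD i 0 0; rewrite addr0 -{1}[carlitz i 0]addr0 (inj_eq (addrI _)) => /eqP.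
Qed.

Lemma carlitzZ i lam x : carlitz i (inF lam * x) = inF lam * carlitz i x.
Proof.
rewrite /carlitz mulr_sumr; apply: eq_bigr => j _.
by rewrite exprMn -rmorphXn frobF mulrCA.
Qed.

Lemma carlitz_sum i I (r : seq I) (P : pred I) (f : I -> C) :
  carlitz i (\sum_(k <- r | P k) f k) = \sum_(k <- r | P k) carlitz i (f k).
Proof. by elim/big_rec2: _ => [|k u v _ <-]; [exact: carlitz_at0 | exact: carlitzD]. Qed.

(** Comparing the two functional equations, [carlitz i.+1] is proportional to
[carlitz i ^+ q - carlitz i], which is zero wherever [carlitz i] is 0 or 1. *)
Lemma carlitz_one i : carlitz i.+1 1 = 0.
Proof.
have E k : carlitz k.+1 1 * (theta ^+ (q ^ k.+1) - theta) = carlitz k 1 ^+ q - carlitz k 1.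
  have E := etrans (esym (carlitz_theta k 1)) (carlitz_theta_step k 1).
  apply/eqP; rewrite -subr_eq0; apply/eqP.
  transitivity ((theta ^+ (q ^ k.+1) * carlitz k.+1 1 + carlitz k 1)
      - (theta * carlitz k.+1 1 + carlitz k 1 ^+ q)).
    by ring.
  by rewrite -E subrr.
have nz k : theta ^+ (q ^ k.+1) - theta != 0.
  by rewrite -{2}[theta]expr1 -(expn0 q); apply/th_neq/qX_neq.
elim: i => [|i IH].
  by apply: (mulIf (nz 0%N)); rewrite E mul0r carlitz_0 expr1n subrr.
by apply: (mulIf (nz i.+1)); rewrite E mul0r IH expr0n (gtn_eqF (ltnW q_gt1)) subrr.
Qed.

Lemma carlitz_Xn i n : (n <= i)%N -> carlitz i (theta ^+ n) = (n == i)%:R.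
Proof.
elim: n i => [|n IH] [|i] //; first by rewrite carlitz_0.
  by rewrite carlitz_one.
rewrite ltnS => ni; rewrite exprS carlitz_theta !IH ?(leqW ni) // eqSS (ltn_eqF (ni : n < i.+1)%N).
rewrite mulr0 add0r.
by case: eqP => _; rewrite ?expr1n // expr0n (gtn_eqF (ltnW q_gt1)).
Qed.

Lemma evE (a : {poly F}) n x : (size a <= n)%N ->
  ev inF a x = \sum_(k < n) inF a`_k * x ^+ k.
Proof.
move=> an; rewrite /ev (@horner_coef_wide _ n) ?size_map_poly //.
by apply: eq_bigr => k _; rewrite coef_map.
Qed.

Lemma carlitz_ev_lt i (a : {poly F}) : (size a <= i)%N -> carlitz i a%:th = 0.
Proof.
move=> ai; rewrite (evE _ ai) carlitz_sum big1 // => k _.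
by rewrite carlitzZ carlitz_Xn ?(ltnW (ltn_ord k)) // (ltn_eqF (ltn_ord k)) mulr0.
Qed.

Lemma carlitz_ev_monic i (a : {poly F}) : a \is monic -> size a = i.+1 -> carlitz i a%:th = 1.
Proof.
move=> ma sa; rewrite (@evE _ i.+1) ?sa // big_ord_recr carlitzD carlitz_sum big1 => [|k _].
  rewrite carlitzZ carlitz_Xn // eqxx mulr1 add0r.
  by move/monicP: ma; rewrite lead_coefE sa /= => ->; rewrite rmorph1.
by rewrite carlitzZ carlitz_Xn ?(ltnW (ltn_ord k)) // (ltn_eqF (ltn_ord k)) mulr0.
Qed.

Definition nbasis d (t : C) : C := \prod_(j < d) (t - theta ^+ (q ^ j)).

Lemma nbasisS d t : nbasis d.+1 t = nbasis d t * (t - theta ^+ (q ^ d)).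
Proof. by rewrite /nbasis big_ord_recr. Qed.

(** Newton interpolation at the points [theta ^+ (q ^ j)]: multiplication by [t]
sends [b_i] to [b_(i+1) + theta^(q^i) b_i], and [carlitz_theta_step] is the same
rule on coefficients. *)
Lemma ev_newton (a : {poly F}) n t : (size a <= n)%N ->
  ev inF a t = \sum_(i < n) carlitz i a%:th * nbasis i t.
Proof.
move=> an.
have X m N : (m < N)%N -> t ^+ m = \sum_(i < N) carlitz i (theta ^+ m) * nbasis i t.
  elim: m N => [|m IH] [|N] // mN.
    rewrite big_ord_recl carlitz_0 /nbasis big_ord0 mulr1 big1 ?addr0 // => i _.
    by rewrite lift0 carlitz_one mul0r.
  rewrite exprS (IH N) // mulr_sumr big_ord_recl carlitz_0.
  under [X in _ = _ + X]eq_bigr do rewrite lift0 exprS carlitz_theta_step mulrDl.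
  rewrite big_split /= addrA.
  have -> : theta ^+ m.+1 * nbasis 0 t +
      \sum_(i < N) theta ^+ (q ^ i.+1) * carlitz i.+1 (theta ^+ m) * nbasis i.+1 t =
      \sum_(i < N.+1) theta ^+ (q ^ i) * carlitz i (theta ^+ m) * nbasis i t.
    rewrite [RHS]big_ord_recl carlitz_0 expn0 expr1 exprS; congr (_ + _).
  have mN1 : (m < N)%N := mN.
  rewrite big_ord_recr /= carlitz_Xn ?(ltnW mN1) // (ltn_eqF mN1).
  rewrite mulr0 mul0r addr0 -big_split /=; apply: eq_bigr => i _.
  by rewrite nbasisS; ring.
rewrite (evE _ an) (eq_bigr (fun k : 'I_n => \sum_(i < n)
  inF a`_k * (carlitz i (theta ^+ k) * nbasis i t))); last first.
  by move=> k _; rewrite (X k n) ?ltn_ord // mulr_sumr.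
rewrite exchange_big /=; apply: eq_bigr => i _.
rewrite (evE _ an) carlitz_sum mulr_suml; apply: eq_bigr => k _.
by rewrite carlitzZ mulrA.
Qed.


Lemma sum_ord_trunc (V : zmodType) m n (f : nat -> V) : (m <= n)%N ->
  (forall l, (m <= l)%N -> f l = 0) -> \sum_(l < n) f l = \sum_(l < m) f l.
Proof.
move=> mn f0; rewrite (big_ord_widen n f mn) [RHS]big_mkcond /=.
by apply: eq_bigr => l _; case: ltnP => // /f0.
Qed.

(** * Power sums *)

Definition carlitz_poly i : {poly C} := \sum_(j < i.+1) carlitz_coef i j *: 'X^(q ^ j)%N.

Lemma horner_carlitz i x : (carlitz_poly i).[x] = carlitz i x.
Proof. by rewrite horner_sum; apply: eq_bigr => j _; rewrite hornerZ hornerXn. Qed.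

Lemma carlitz_coef_gt i j : (i < j)%N -> carlitz_coef i j = 0.
Proof. by move=> ij; rewrite /carlitz_coef leqNgt ij. Qed.

Lemma coef_carlitz i s j : (s < q ^ j)%N ->
  (carlitz_poly i)`_s = \sum_(l < j) carlitz_coef i l * (s == q ^ l)%N%:R.
Proof.
move=> sj; rewrite coef_sum.
under eq_bigr do rewrite coefZ coefXn.
rewrite -(@sum_ord_trunc _ i.+1 (i.+1 + j)
  (fun l => carlitz_coef i l * (s == q ^ l)%N%:R)) ?leq_addr //.
  apply: (@sum_ord_trunc _ j _ (fun l => carlitz_coef i l * (s == q ^ l)%N%:R)) => [|l jl].
    exact: leq_addl.
  rewrite (ltn_eqF (leq_trans sj _)) ?mulr0 //.
  by rewrite leq_exp2l ?q_gt1.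
by move=> l il; rewrite carlitz_coef_gt ?mul0r.
Qed.

Lemma coef_carlitz_q i j : (carlitz_poly i)`_(q ^ j) = carlitz_coef i j.
Proof.
rewrite (@coef_carlitz i _ j.+1) ?ltn_exp2l ?q_gt1 //.
rewrite big_ord_recr /= eqxx mulr1 big1 ?add0r // => l _.
by rewrite eqn_exp2l ?q_gt1 // (gtn_eqF (ltn_ord l)) mulr0.
Qed.

Lemma coef_carlitz0 i : (carlitz_poly i)`_0 = 0.
Proof. by rewrite (@coef_carlitz i 0 0) ?expn0 // big_ord0. Qed.

Lemma size_carlitz i : size (carlitz_poly i) = (q ^ i).+1.
Proof.
rewrite /carlitz_poly big_ord_recr /= addrC size_polyDl.
  rewrite size_scale ?size_polyXn // /carlitz_coef leqnn subnn /lc big_geq // expr1n invr1 mulr1.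
  by rewrite invr_eq0 Dc_neq0.
rewrite size_scale; last first.
  by rewrite /carlitz_coef leqnn subnn /lc big_geq // expr1n invr1 mulr1 invr_eq0 Dc_neq0.
rewrite size_polyXn ltnS (leq_trans (size_sum _ _ _)) //.
apply/bigmax_leqP => j _; rewrite (leq_trans (size_scale_leq _ _)) // size_polyXn.
by rewrite ltn_exp2l ?q_gt1.
Qed.

Lemma deriv_carlitz i : (carlitz_poly i)^`() = (carlitz_coef i 0)%:P.
Proof.
rewrite /carlitz_poly linear_sum big_ord_recl /= expn0 expr1 derivZ derivX alg_polyC.
rewrite big1 ?addr0 // => j _; rewrite derivZ derivXn /bump /= add1n expnS.
by rewrite -mulr_natr natrM -polyC_natr natq0 polyC0 mul0r mulr0 scaler0.
Qed.

Lemma ev_inj : injective (fun a : {poly F} => a%:th).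
Proof.
move=> a b /= ab; apply/eqP; rewrite -subr_eq0; apply/eqP/th_transc.
by rewrite evB ab subrr.
Qed.

Lemma ev_shift_inj d : injective (fun c : {poly_d F} => ('X^d + c)%:th).
Proof. by move=> a b /ev_inj /addrI /npoly_inj. Qed.

Lemma card_polyF d : #|{poly_d F}| = (q ^ d)%N.
Proof. exact: card_npoly. Qed.

(** The monic polynomials of degree [d] are the roots of [carlitz_poly d - 1], so
the logarithmic derivative of the latter computes their power sums. *)
Lemma carlitz1_spec d :
  [/\ size (carlitz_poly d - 1) = #|{poly_d F}|.+1,
      (carlitz_poly d - 1)^`() = (carlitz_coef d 0)%:P,
      forall c : {poly_d F}, root (carlitz_poly d - 1) ('X^d + c)%:th
    & (carlitz_poly d - 1)`_0 = -1].
Proof.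
split.
- rewrite card_polyF size_polyDl size_carlitz // size_polyN size_poly1.
  by rewrite ltnS expn_gt0 (ltnW q_gt1).
- by rewrite derivB derivC subr0 deriv_carlitz.
- move=> c; rewrite /root !(hornerD, hornerN) horner_carlitz hornerC.
  have /andP[mc /eqP sc] := monic_shift (size_npoly c).
  by rewrite (carlitz_ev_monic mc sc) subrr.
- by rewrite coefB coef1 coef_carlitz0 sub0r.
Qed.

Lemma powersumE d n :
  powersum inF theta d n = monicsum d (fun a => a%:th ^- n).
Proof. by []. Qed.

Lemma powersum1 d : powersum inF theta d 1 = carlitz_coef d 0.
Proof.
have [sz dr rt c0] := carlitz1_spec d; rewrite powersumE monicsumE.
by rewrite -(sum_inv_roots (@ev_shift_inj d) rt sz dr c0).
Qed.

Lemma monicsum_exp d m : (m.+1 < q ^ d)%N ->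
  monicsum d (fun a : {poly F} => a%:th ^+ m) = 0.
Proof.
have [sz dr rt c0] := carlitz1_spec d; rewrite monicsumE => md.
by apply: (sum_roots_exp (@ev_shift_inj d) rt sz dr); rewrite card_polyF.
Qed.

Lemma sum_neq0_inv d m : (forall lam : F, lam != 0 -> lam ^+ m = 1) ->
  \sum_(c : {poly_d F} | c != 0) (c : {poly F})%:th ^- m =
  - \sum_(i < d) powersum inF theta i m.
Proof.
move=> lam1; rewrite (sum_npoly_neq0 d (fun c => c%:th ^- m)).
rewrite (eq_bigr (fun=> \sum_(i < d) powersum inF theta i m)); last first.
  move=> lam lam0; apply: eq_bigr => i _; rewrite powersumE; apply: eq_monicsum => c _ _.
  by rewrite evZ exprMn -rmorphXn lam1 // rmorph1 mul1r.
rewrite sumr_const cardC1; set x := \sum_(i < d) _.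
apply/eqP; rewrite -addr_eq0 -mulrSr prednK ?(ltnW q_gt1) //.
by rewrite -mulr_natr natq0 mulr0.
Qed.

(** The roots of [carlitz_poly i] are the polynomials of degree less than [i]. Its
logarithmic derivative, read coefficient by coefficient, expresses the
coefficients through power sums, with coefficients in the prime field. *)
Lemma carlitz_coef_rec i j : (0 < j)%N ->
  carlitz_coef i j =
  - \sum_(l < j) carlitz_coef i l * \sum_(d < i) powersum inF theta d (q ^ j - q ^ l).
Proof.
move=> j0.
have qj : (1 < q ^ j)%N by rewrite -(expn0 q) ltn_exp2l ?q_gt1.
have inj0 : injective (fun c : {poly_i F} => (c : {poly F})%:th).
  by move=> a b /ev_inj /npoly_inj.
have rt0 (c : {poly_i F}) : root (carlitz_poly i) (c : {poly F})%:th.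
  by rewrite /root horner_carlitz carlitz_ev_lt // size_npoly.
have sz0 : size (carlitz_poly i) = #|{poly_i F}|.+1 by rewrite size_carlitz card_polyF.
have r0 : ((0 : {poly_i F}) : {poly F})%:th = 0 by rewrite /ev rmorph0 horner0.
have := coef_sum_roots inj0 rt0 sz0 (deriv_carlitz i) (q ^ j - 2) r0.
have -> : (q ^ j - 2).+2 = (q ^ j)%N by lia.
rewrite coef_carlitz_q => ->.
under eq_bigr => s _ do rewrite (coef_carlitz _ (ltn_ord s)) mulr_suml.
rewrite exchange_big -sumrN /=; apply: eq_bigr => l _.
have lj : (q ^ l < q ^ j)%N by rewrite ltn_exp2l ?q_gt1.
rewrite (bigD1 (Ordinal lj)) //= eqxx mulr1 [X in _ + X]big1 ?addr0 => [|s]; last first.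
  move=> sl; have /negbTE-> : (s : nat) != (q ^ l)%N.
    by apply: contra sl => /eqP E; apply/eqP/val_inj.
  by rewrite mulr0 mul0r.
rewrite sum_neq0_inv ?mulrN // => lam lam0.
apply: (mulIf (expf_neq0 (q ^ l) lam0)); rewrite -exprD subnK ?(ltnW lj) //.
by rewrite !frobF mul1r.
Qed.

(** The coefficients of [Q] from [n] on are multiplied by power sums whose exponent
lies between 0 and [q ^ d - 2]; these vanish by [monicsum_exp]. *)
Lemma powersum_reduce d n (Q : {poly C}) : (0 < n)%N ->
  (size Q <= (q ^ d).-1 + n)%N ->
  monicsum d (fun a => a%:th ^- n * Q.[a%:th]) =
  \sum_(m < n) Q`_m * powersum inF theta d (n - m).
Proof.
move=> n0 sQ.
pose g m := Q`_m * monicsum d (fun a : {poly F} => a%:th ^- n * a%:th ^+ m).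
transitivity (\sum_(m < n + size Q) g m).
  transitivity (\sum_(m < n + size Q)
      monicsum d (fun a : {poly F} => Q`_m * (a%:th ^- n * a%:th ^+ m))); last first.
    by apply: eq_bigr => m _; rewrite /g /monicsum mulr_sumr.
  rewrite -monicsum_sum; apply: eq_monicsum => a ma sa.
  rewrite (@horner_coef_wide _ (n + size Q)) ?leq_addl // mulr_sumr.
  by apply: eq_bigr => m _; rewrite mulrCA.
have nz := ev_monic_neq0 th_transc.
rewrite (@sum_ord_trunc _ n _ g) ?leq_addr //.
  apply: eq_bigr => m _; rewrite /g powersumE; congr (_ * _); apply: eq_monicsum => a ma _.
  have mn : (m + (n - m) = n)%N by rewrite subnKC // ltnW.
  rewrite -{1}mn exprD invfM mulrAC mulVf ?mul1r // expf_neq0 //; exact: nz.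
move=> m nm; rewrite /g; have [mQ|mQ] := ltnP m (size Q); last first.
  by rewrite nth_default // mul0r.
rewrite (@eq_monicsum _ _ _ _ (fun a => a%:th ^+ (m - n))) => [|a ma _]; last first.
  rewrite -{1}(subnKC nm) exprD mulrA mulVf ?mul1r // expf_neq0 //; exact: nz.
by rewrite monicsum_exp ?mulr0 //; lia.
Qed.

End CarlitzPolynomials.

Section Compare.
Variables (F : finFieldType) (C : fieldType) (inF : {rmorphism F -> C}) (theta : C).
Variables (p e : nat).
Hypotheses (pC : p \in [pchar C]) (e_gt0 : (0 < e)%N) (cardF : #|F| = (p ^ e)%N).
Hypothesis th_transc : forall a : {poly F}, ev inF a theta = 0 -> a = 0.

Local Notation q := #|F|.
Local Notation "a %:th" := (ev inF a theta) (at level 2, format "a %:th").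

(** * Two systems of letters *)

Variables (I : finType) (T : Type) (y : I -> T -> C).
Hypothesis cardI : (#|I| < q)%N.

Local Notation B := (carlitz_coef F theta).
Local Notation b := (nbasis F theta).
Local Notation pw := (powersum inF theta).

Definition zeta_factor (k : I) (a : {poly F}) (t : T) : C := ev inF a (y k t).
Definition lambda_factor (k : I) (a : {poly F}) (t : T) : C := b (size a).-1 (y k t).
Definition zeta_letter := letter inF theta zeta_factor.
Definition lambda_letter := letter inF theta lambda_factor.

Lemma zeta_letter_closed : mul_closed zeta_letter.
Proof.
apply: (letter_closed th_transc (eps := true)) => k t a c lam _ _ _.
by rewrite /zeta_factor evD evZ mul1r.
Qed.

Lemma lambda_letter_closed : mul_closed lambda_letter.
Proof.
apply: (letter_closed th_transc (eps := false)) => k t a c lam ma mc ca.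
rewrite !mul0r addr0 /lambda_factor size_polyDl //.
by rewrite (leq_ltn_trans (size_scale_leq _ _)).
Qed.

Lemma lambda_letterE U n d t : lambda_letter U n d t = pw d n * \prod_(k in U) b d (y k t).
Proof.
rewrite /lambda_letter /letter powersumE /monicsum mulr_suml; apply: eq_bigr => a /andP[_ /eqP sa].
by rewrite /lambda_factor sa.
Qed.

(** The coefficient of [x ^+ (q ^ j)] in the polynomial [vpoly] below; the point is
that it is itself a combination of words. *)
Definition vcoef k j : nat -> T -> C := psum (fun d t => B d j * b d (y k t)).

Lemma vcoefE k j d t : vcoef k j d t = \sum_(i < d) B i j * b i (y k t).
Proof. by rewrite /vcoef /psum sum_app. Qed.

(** By induction on [j]: the recursion for the Carlitz coefficients multiplies heads
of smaller weight by power sums, which are words without variables. *)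
Lemma vcoef_words k j : words lambda_letter [set k] (q ^ j) (vcoef k j).
Proof.
apply: psum_heads; have [n] := ubnP j; elim: n j => // n IH [_|j ltj].
  rewrite expn0; have -> : (fun d t => B d 0 * b d (y k t)) = lambda_letter [set k] 1.
    apply/funext => d; apply/funext => t.
    by rewrite lambda_letterE big_set1 (powersum1 pC e_gt0 cardF th_transc).
  exact: heads1.
have -> : (fun d t => B d j.+1 * b d (y k t)) = - \sum_(l < j.+1)
     ((fun d t => B d l * b d (y k t)) * psum (lambda_letter finset.set0 (q ^ j.+1 - q ^ l))).
  apply/funext => d; apply/funext => t.
  rewrite -[RHS]/(- ((\sum_(l < j.+1) _ : nat -> T -> C) d t)) !sum_app.
  rewrite (carlitz_coef_rec pC e_gt0 cardF th_transc) // mulNr mulr_suml; congr (- _).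
  apply: eq_bigr => l _; rewrite -mulrA [_ * b _ _]mulrC mulrA.
  rewrite -[RHS]/(B d l * b d (y k t) * _); congr (_ * _).
  by rewrite /psum sum_app; apply: eq_bigr => i _; rewrite lambda_letterE big_set0 mulr1.
apply: zspanN; apply: zspan_sum => l _.
have lj : (q ^ l < q ^ j.+1)%N by rewrite ltn_exp2l // (q_gt1 pC e_gt0 cardF).
have := @heads_mul _ _ lambda_letter [set k] finset.set0 (q ^ l) (q ^ j.+1 - q ^ l).
rewrite finset.setU0 subnKC ?(ltnW lj) // => Hm; apply: Hm.
- exact: lambda_letter_closed.
- by rewrite disjoint_sym finset.disjoints_subset finset.sub0set.
- by apply: IH; rewrite (leq_trans (ltn_ord l)).
- by apply: psum_heads; apply: heads1; rewrite subn_gt0.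
Qed.

(** Newton interpolation, read as a polynomial in the value at [theta]: on the monic
polynomials of degree [d] it computes the value at [y k t]. *)
Definition vpoly k d t : {poly C} :=
  (b d (y k t))%:P + \sum_(j < d) (vcoef k j d t) *: 'X^(q ^ j)%N.

Lemma horner_vpoly k d t a : a \is monic -> size a = d.+1 ->
  (vpoly k d t).[a%:th] = ev inF a (y k t).
Proof.
move=> ma sa; rewrite (ev_newton pC e_gt0 cardF th_transc (y k t) (n := d.+1)) ?sa //.
rewrite big_ord_recr /= (carlitz_ev_monic pC e_gt0 cardF th_transc) // mul1r addrC.
rewrite /vpoly hornerD hornerC horner_sum; congr (_ + _).
under [LHS]eq_bigr do rewrite hornerZ hornerXn vcoefE mulr_suml.
rewrite exchange_big /=; apply: eq_bigr => i _.
rewrite /carlitz -(@sum_ord_trunc _ i.+1 d (fun j => B i j * a%:th ^+ (q ^ j))) //.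
  by rewrite mulr_suml; apply: eq_bigr => j _; rewrite mulrAC.
by move=> j ij; rewrite carlitz_coef_gt ?mul0r.
Qed.

Definition vprod (U : {set I}) d t : {poly C} := \prod_(k in U) vpoly k d t.

(** A product of at most [q - 1] factors of degree at most [q ^ d.-1]: here the
number of variables has to be less than [q]. *)
Lemma size_vprod U d t : (size (vprod U d t) <= q ^ d)%N.
Proof.
have q1 := q_gt1 pC e_gt0 cardF.
have szP k : (size (vpoly k d t) <= (q ^ d.-1).+1)%N.
  rewrite (leq_trans (size_polyD _ _)) // geq_max; apply/andP; split.
    by rewrite (leq_trans (size_polyC_leq1 _)).
  rewrite (leq_trans (size_sum _ _ _)) //; apply/bigmax_leqP => j _.
  rewrite (leq_trans (size_scale_leq _ _)) // size_polyXn ltnS.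
  by rewrite leq_exp2l //; have := ltn_ord j; lia.
case: d szP => [|d] szP.
  rewrite expn0 /vprod (eq_bigr (fun k => (b 0 (y k t))%:P)); last first.
    by move=> k _; rewrite /vpoly big_ord0 addr0.
  by rewrite -rmorph_prod size_polyC_leq1.
rewrite (leq_trans (size_poly_prod_leq _ _)) //.
have sle : (\sum_(k in U) size (vpoly k d.+1 t) <= #|U| * (q ^ d).+1)%N.
  by rewrite -sum_nat_const; apply: leq_sum => k _; exact: szP.
have Uq2 : (#|U| < q)%N by apply: leq_ltn_trans cardI; exact: max_card.
have q0 : (0 < q ^ d)%N by rewrite expn_gt0 (ltnW q1).
rewrite leq_subLR expnS (_ : #|in_mem^~ (mem U)| = #|U|) //.
have QQ : (#|U| * q ^ d < q * q ^ d)%N by rewrite ltn_pmul2r.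
by rewrite mulnS in sle; rewrite (leq_ltn_trans sle) // ltn_add2l.
Qed.

Lemma zeta_letterE U n d t : (0 < n)%N ->
  zeta_letter U n d t = \sum_(m < n) (vprod U d t)`_m * pw d (n - m).
Proof.
move=> n0; rewrite -(powersum_reduce pC e_gt0 cardF th_transc) //.
  apply: eq_monicsum => a ma sa; rewrite /vprod horner_prod; congr (_ * _).
  by apply: eq_bigr => k _; rewrite (horner_vpoly _ _ ma sa).
by have := size_vprod U d t; lia.
Qed.

(* The variables in [W] are attached to the outer index [d]; those in [V] have been
   absorbed into a word. *)
Let mixed (U : {set I}) n : (nat -> T -> C) -> Prop :=
  zspan (fun u => exists (W V : {set I}) v, [/\ [disjoint W & V], W :|: V = U,
    words lambda_letter V n v & u = (fun d t => \prod_(k in W) b d (y k t)) * v]).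

Let mixed_nbasis k (U : {set I}) n u : k \notin U -> mixed U n u ->
  mixed (k |: U) n ((fun d t => b d (y k t)) * u).
Proof.
move=> kU; move: u; apply: (zspan_map (f := fun u => (fun d t => b d (y k t)) * u)).
  by move=> u v; exact: mulrBr.
move=> u [W [V [v [dWV defU Vv ->]]]]; apply: zspan_in.
move: kU; rewrite -defU finset.inE negb_or => /andP[kW kV].
exists (k |: W), V, v; split=> //.
- by rewrite disjointUl dWV andbT disjoints1.
- by rewrite finset.setUA.
by rewrite mulrA; congr (_ * _); apply/funext => d; apply/funext => t; rewrite big_setU1.
Qed.

Let mixed_vcoef k (U : {set I}) j n u : k \notin U -> mixed U n u ->
  mixed (k |: U) (q ^ j + n) (vcoef k j * u).
Proof.
move=> kU; move: u; apply: (zspan_map (f := fun u => vcoef k j * u)).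
  by move=> u v; exact: mulrBr.
move=> u [W [V [v [dWV defU Vv ->]]]]; apply: zspan_in.
move: kU; rewrite -defU finset.inE negb_or => /andP[kW kV].
exists W, (k |: V), (vcoef k j * v); split=> //.
- by rewrite disjointUr dWV andbT disjoint_sym disjoints1.
- by rewrite finset.setUCA.
- apply: words_mul => //.
  + exact: lambda_letter_closed.
  + by rewrite disjoints1.
  + exact: vcoef_words.
- by rewrite mulrCA.
Qed.

(** In the product with one more [vpoly k], either its constant term [b_d] is
chosen, or one of its other coefficients, which is a word of weight [q ^ j]. *)
Let mixed_vprod (U : {set I}) m : mixed U m (fun d t => (vprod U d t)`_m).
Proof.
have [n] := ubnP #|U|; elim: n U m => // n IH U m ltn.
have [->|[k kU]] := finset.set_0Vmem U.
  have -> : (fun d t => (vprod finset.set0 d t)`_m) = (m == 0%N)%:R :> (nat -> T -> C).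
    apply/funext => d; apply/funext => t; rewrite /vprod big_set0 coef1.
    by case: eqP.
  case: eqP => [->|_]; last exact: zspan0.
  apply: zspan_in; exists finset.set0, finset.set0, 1; split.
  - by rewrite finset.disjoints_subset finset.sub0set.
  - by rewrite finset.setU0.
  - exact: words1.
  - rewrite mulr1; apply/funext => d; apply/funext => t; by rewrite big_set0.
pose U' := U :\ k.
have defU : U = k |: U' by rewrite finset.setD1K.
have kU' : k \notin U' by rewrite !finset.inE eqxx.
have ltU' : (#|U'| < n)%N by move: ltn; rewrite [#|U|](cardsD1 k) kU.
have -> : (fun d t => (vprod U d t)`_m) =
    (fun d t => b d (y k t)) * (fun d t => (vprod U' d t)`_m) +
    \sum_(j < m.+1 | (q ^ j <= m)%N) vcoef k j * (fun d t => (vprod U' d t)`_(m - q ^ j)).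
  apply/funext => d; apply/funext => t.
  rewrite -[RHS]/(b d (y k t) * (vprod U' d t)`_m + (\sum_(j < m.+1 | _) _ : nat -> T -> C) d t).
  rewrite !sum_app {1}/vprod defU big_setU1 //= -/(vprod U' d t) mulrDl coefD coefCM.
  congr (_ + _); rewrite mulr_suml coef_sum.
  pose g j := vcoef k j d t * (if (q ^ j <= m)%N then (vprod U' d t)`_(m - q ^ j) else 0).
  transitivity (\sum_(j < d) g j).
    apply: eq_bigr => j _; rewrite /g -scalerAl coefZ mulrC -mulrC coefXnM ltnNge.
    by case: leqP.
  (* The range must not depend on [d]: [vcoef] is zero for [j >= d], and
     [q ^ j > m] for [j > m]. *)
  rewrite -(@sum_ord_trunc _ d (d + m.+1) g) ?leq_addr //; last first.
    move=> j dj; rewrite /g vcoefE big1 ?mul0r // => i _.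
    by rewrite carlitz_coef_gt ?mul0r // (leq_trans (ltn_ord i)).
  rewrite (@sum_ord_trunc _ m.+1 (d + m.+1) g) ?leq_addl //; last first.
    move=> j mj; rewrite /g; case: leqP => [qm|_]; last by rewrite mulr0.
    have := ltn_expl j (q_gt1 pC e_gt0 cardF); lia.
  rewrite [RHS]big_mkcond; apply: eq_bigr => j _; rewrite /g.
  by case: leqP; rewrite ?mulr0.
have mixE u k0 : mixed (k |: U') k0 u -> mixed U k0 u by rewrite -defU.
apply: zspanD; first by apply/mixE/mixed_nbasis => //; exact: IH.
apply: zspan_sum => j qm; apply: mixE.
have /= := mixed_vcoef j kU' (IH U' (m - q ^ j)%N ltU'); rewrite subnKC //; exact.
Qed.

Let ps n : nat -> T -> C := fun d _ => pw d n.

Let ps_mixed h (U : {set I}) n m u : mul_closed h ->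
  (forall (W V : {set I}) v, [disjoint W & V] -> W :|: V = U -> words lambda_letter V m v ->
     heads h U (n + m) (lambda_letter W n * v)) ->
  mixed U m u -> heads h U (n + m) (ps n * u).
Proof.
move=> hc hh; move: u; apply: (zspan_map (f := fun u => ps n * u)).
  by move=> u v; exact: mulrBr.
move=> u [W [V [v [dWV defU Vv ->]]]].
have -> : ps n * ((fun d t => \prod_(k in W) b d (y k t)) * v) = lambda_letter W n * v.
  rewrite mulrA; congr (_ * _); apply/funext => d; apply/funext => t.
  by rewrite lambda_letterE.
exact: (hh _ _ _ dWV defU Vv).
Qed.

Let zeta_letter_sum U n : (0 < n)%N ->
  zeta_letter U n = \sum_(m < n) ps (n - m) * (fun d t => (vprod U d t)`_m).
Proof.
move=> n0; apply/funext => d; apply/funext => t; rewrite zeta_letterE // !sum_app.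
by apply: eq_bigr => m _; rewrite mulrC.
Qed.

Lemma zeta_letter_heads U n : (0 < n)%N -> heads lambda_letter U n (zeta_letter U n).
Proof.
move=> n0; rewrite zeta_letter_sum //; apply: zspan_sum => m _.
have := @ps_mixed lambda_letter U (n - m) m _ lambda_letter_closed _ (mixed_vprod U m).
rewrite subnK ?(ltnW (ltn_ord m)) //; apply.
move=> W V v dWV <- Vv; have := @heads_in _ _ lambda_letter W V (n - m) m v dWV.
by rewrite subnK ?(ltnW (ltn_ord m)) // subn_gt0; apply.
Qed.

(** The term [m = 0] of [zeta_letter_sum] is the lambda letter; the other terms
contain letters and words of smaller weight only, which are known by induction. *)
Lemma lambda_letter_heads U n : (0 < n)%N -> heads zeta_letter U n (lambda_letter U n).
Proof.
have [N] := ubnP n; elim: N U n => // N IH U [//|n] ltn _.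
have -> : lambda_letter U n.+1 = zeta_letter U n.+1 -
    \sum_(m < n) ps (n - m) * (fun d t => (vprod U d t)`_m.+1).
  rewrite zeta_letter_sum // big_ord_recl addrK; apply/funext => d; apply/funext => t.
  rewrite -[RHS]/(pw d n.+1 * (vprod U d t)`_0) lambda_letterE /vprod coef0_prod.
  congr (_ * _); apply: eq_bigr => k _.
  rewrite /vpoly coefD coefC eqxx coef_sum big1 ?addr0 // => j _.
  rewrite coefZ coefXn eq_sym expn_eq0.
  by rewrite (gtn_eqF (ltnW (q_gt1 pC e_gt0 cardF))) mulr0.
apply: zspanB; first exact: heads1.
apply: zspan_sum => m _; have mn := ltn_ord m.
have nE : (n - m + m.+1 = n.+1)%N by rewrite addnS subnK // ltnW.
have := @ps_mixed zeta_letter U (n - m) m.+1 _ zeta_letter_closed _ (mixed_vprod U m.+1).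
rewrite nE; apply => W V v dWV <- Vv; rewrite -nE.
apply: heads_mul => //; first exact: zeta_letter_closed.
  by apply: IH; lia.
apply: (words_transfer zeta_letter_closed (N := m.+1) _ _ Vv) => // {}U k /andP[k0 km].
by apply: IH; lia.
Qed.

Lemma words_zeta_lambda U n u : words zeta_letter U n u <-> words lambda_letter U n u.
Proof.
split.
  apply: (words_transfer lambda_letter_closed (N := n)) => // V m /andP[m0 _].
  exact: zeta_letter_heads.
apply: (words_transfer zeta_letter_closed (N := n)) => // V m /andP[m0 _].
exact: lambda_letter_heads.
Qed.

End Compare.

(** * Iterated sums as sums over tuples *)

Section Nest.
Variable C : comPzRingType.

Section Def.
Variables (L : Type) (W : L -> nat -> C).

Fixpoint nest (M : seq L) (D : nat) : C :=
  if M is c :: M' then \sum_(d < D) W c d * nest M' d else 1.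

End Def.

Lemma nest_map (L L' : Type) (g : L -> L') (W : L' -> nat -> C) M D :
  nest W (map g M) D = nest (fun c => W (g c)) M D.
Proof. by elim: M D => //= c M IH D; apply: eq_bigr => d _; rewrite IH. Qed.

Lemma eq_nest (L : eqType) (W W' : L -> nat -> C) M D :
  (forall c d, c \in M -> (d < D)%N -> W c d = W' c d) -> nest W M D = nest W' M D.
Proof.
elim: M D => //= c M IH D WW; apply: eq_bigr => d _.
rewrite WW ?inE ?eqxx // IH // => c' d' c'M d'd; apply: WW.
  by rewrite inE c'M orbT.
exact: ltn_trans (ltn_ord d).
Qed.

Lemma wsum_nest (I : finType) (T : Type) (h : {set I} -> nat -> nat -> T -> C) M D t :
  wsum (h : {set I} -> nat -> nat -> (T -> C)) M D t = nest (fun c d => h c.1 c.2 d t) M D.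
Proof.
elim: M D => //= c M IH D; rewrite sum_app; apply: eq_bigr => d _.
by rewrite -IH.
Qed.

Lemma big_tuple_cons (K : finType) n (P : pred (n.+1.-tuple K)) (G : n.+1.-tuple K -> C) :
  \sum_(a | P a) G a =
  \sum_(x : K) \sum_(a : n.-tuple K | P [tuple of x :: a]) G [tuple of x :: a].
Proof.
rewrite pair_big_dep /=.
rewrite (reindex (fun xa : K * n.-tuple K => [tuple of xa.1 :: xa.2])) //=.
exists (fun a : n.+1.-tuple K => (thead a, [tuple of behead a])) => [[x a] _|a _] /=.
  by congr (_, _); apply: val_inj.
by rewrite -tuple_eta.
Qed.

(** A decreasing tuple is its head, followed by a decreasing tuple bounded by the
head. *)
Lemma tuple_nest (L : Type) (K : finType) (P : pred K) (sz : K -> nat)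
    (w : L -> K -> C) (M : seq L) D :
  \sum_(a : (size M).-tuple K | [&& all P a, sorted (fun x y => (sz y < sz x)%N) a
                                 & all (fun x => (sz x < D)%N) a])
     \prod_(j < size M) w (tnth (in_tuple M) j) (tnth a j)
  = nest (fun c d => \sum_(x | P x && (sz x == d)) w c x) M D.
Proof.
elim: M D => [|c M IH] D /=.
  rewrite (big_pred1 [tuple]) ?big_ord0 // => a /=.
  by rewrite tuple0 /= eqxx.
rewrite big_tuple_cons.
have tr : transitive (fun x y => (sz y < sz x)%N) by move=> y x z xy yz; apply: ltn_trans xy.
transitivity (\sum_(x | P x && (sz x < D)%N) w c x *
   nest (fun c d => \sum_(x | P x && (sz x == d)) w c x) M (sz x)).
  rewrite [RHS]big_mkcond; apply: eq_bigr => x _.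
  case: ifP => [/andP[Px xD]|PxD]; last first.
    rewrite big_pred0 // => a /=; rewrite path_sortedE //.
    by move: PxD; case: (P x) => //= ->; rewrite !andbF.
  rewrite -IH mulr_sumr; apply: eq_big => [a|a _] /=.
    rewrite Px xD /= path_sortedE // -!andbA; congr (_ && _).
    rewrite andbCA; congr (_ && _); apply/andP/idP => [[]//|H]; split=> //.
    by apply: sub_all H => y yx; apply: ltn_trans yx xD.
  rewrite big_ord_recl; congr (_ * _); apply: eq_bigr => j _.
  by rewrite tnthS; congr w; rewrite !(tnth_nth c).
under [RHS]eq_bigr do rewrite mulr_suml.
rewrite (exchange_big_dep (fun x => P x && (sz x < D)%N)) /=; last first.
  by move=> d x _ /andP[-> /eqP->]; rewrite ltn_ord.
apply: eq_bigr => x /andP[Px xD]; rewrite (big_pred1 (Ordinal xD)) // => d.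
by rewrite /pred1 /= Px eq_sym.
Qed.

End Nest.

Section NestY.
Variables (C : comPzRingType) (s : nat -> nat -> C) (I : finType).
Implicit Types (y : I -> nat -> C) (M : seq ({set I} * nat)).

(** The letter of index [d] that contains the variable [k] has the factor [y k d].
Values at a point, Newton coefficients and Taylor coefficients of the lambda sums
are obtained by specialising [y]. *)
Definition nestY y M D : C := nest (fun c d => s d c.2 * \prod_(k in (c.1 : {set I})) y k d) M D.

Lemma index_exists N (A : 'I_N -> {set I}) :
  (forall k, (\sum_j (k \in A j : nat))%N = 1%N) ->
  exists J : I -> 'I_N, forall k j, (k \in A j) = (j == J k).
Proof.
move=> HA; suff H k : exists j0, forall j, (k \in A j) = (j == j0).
  by have [J HJ] := boolp.choice H; exists J.
have /eqP := HA k => /sum_nat_eq1[j0 [_ kj0 nk]].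
exists j0 => j; case: eqP => [->|/eqP jj0]; first by case: (_ \in _) kj0.
by have := nk j jj0 isT; case: (_ \in _).
Qed.

Lemma prod_index (R : comPzRingType) N (A : 'I_N -> {set I}) (J : I -> 'I_N)
    (g : I -> 'I_N -> R) : (forall k j, (k \in A j) = (j == J k)) ->
  \prod_j \prod_(k in A j) g k j = \prod_k g k (J k).
Proof.
move=> HJ; rewrite (exchange_big_dep predT) //=; apply: eq_bigr => k _.
by rewrite (big_pred1 (J k)).
Qed.

Lemma wtype_index M n : wtype M [set: I]%SET n ->
  exists J : I -> 'I_(size M), forall k j, (k \in (tnth (in_tuple M) j).1) = (j == J k).
Proof.
case=> _ HM _; apply: (index_exists (A := fun j => (tnth (in_tuple M) j).1)) => k.
by have := HM k; rewrite finset.in_setT big_tnth.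
Qed.

Lemma nestY_tuple y M (J : I -> 'I_(size M)) D :
  (forall k j, (k \in (tnth (in_tuple M) j).1) = (j == J k)) ->
  nestY y M D = \sum_(a : (size M).-tuple 'I_D | sorted (fun x z : 'I_D => (z < x)%N) a)
    (\prod_(j < size M) s (tnth a j) (tnth (in_tuple M) j).2)
    * \prod_k y k (tnth a (J k)).
Proof.
move=> HJ.
have := @tuple_nest C _ 'I_D xpredT val
  (fun c d => s d c.2 * \prod_(k in (c.1 : {set I})) y k d) M D.
rewrite [RHS](@eq_nest _ _ _ (fun c d => s d c.2 * \prod_(k in (c.1 : {set I})) y k d)); last first.
  by move=> c d _ dD; rewrite (big_pred1 (Ordinal dD)).
rewrite -/(nestY y M D) => <-; apply: eq_big => [a|a _].
  by rewrite all_predT /=; case: sorted => //=; apply/seq.allP => x _; apply: ltn_ord.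
by rewrite big_split /=; congr (_ * _); rewrite (prod_index _ HJ).
Qed.

(** Every variable occurs in exactly one letter, so an expansion of the [y k]
expands the whole iterated sum. *)
Lemma nestY_expand M n D y (z : I -> nat -> nat -> C) (phi : I -> nat -> C) :
  wtype M [set: I]%SET n ->
  (forall k d, (d < D)%N -> y k d = \sum_(i < D) z k i d * phi k i) ->
  nestY y M D = \sum_(i : {ffun I -> 'I_D})
    nestY (fun k d => z k (i k) d) M D * \prod_k phi k (i k).
Proof.
move=> /wtype_index[J HJ] yE.
rewrite (nestY_tuple _ _ HJ).
under [RHS]eq_bigr do rewrite (nestY_tuple _ _ HJ) mulr_suml.
rewrite [RHS]exchange_big /=; apply: eq_bigr => a _.
under [X in _ * X = _]eq_bigr do rewrite yE ?ltn_ord //.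
rewrite bigA_distr_bigA mulr_sumr; apply: eq_bigr => i _.
by rewrite big_split /= mulrA.
Qed.

End NestY.

Lemma prod_sum_dffun (C : comPzRingType) (I : finType) (N : I -> nat) (G : I -> nat -> C) :
  \sum_(j : {dffun forall k : I, 'I_(N k).+1}) \prod_k G k (j k) =
  \prod_k \sum_(l < (N k).+1) G k l.
Proof.
pose D := (\max_k N k).+1.
have ND k : (N k < D)%N by rewrite ltnS leq_bigmax.
transitivity (\prod_k \sum_(l < D | (l < (N k).+1)%N) G k l); last first.
  by apply: eq_bigr => k _; rewrite (big_ord_widen D).
rewrite bigA_distr_big_dep.
rewrite (reindex_onto (fun j : {dffun forall k : I, 'I_(N k).+1} =>
           [ffun k => inord (j k) : 'I_D])
         (fun f : {ffun I -> 'I_D} =>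
           finfun (fun k => inord (f k) : 'I_(N k).+1))) /=; last first.
  move=> f /familyP fN; apply/ffunP => k; rewrite !ffunE; apply: val_inj => /=.
  have := fN k; rewrite unfold_in => fk.
  by rewrite [X in inord X]inordK // inordK.
have jD (j : {dffun forall k : I, 'I_(N k).+1}) k : (j k < D)%N.
  by apply: leq_trans (ltn_ord (j k)) (ND k).
apply: eq_big => [j|j _].
  apply/esym/andP; split.
    by apply/familyP => k; rewrite unfold_in ffunE inordK.
  by apply/eqP/ffunP => k; rewrite !ffunE inordK // inord_val.
by apply: eq_bigr => k _; rewrite ffunE inordK.
Qed.

(** * Absolute values and limits *)

Lemma halving_to0 (R : realType) (u : nat -> R) N0 : (forall d, 0 <= u d) ->
  (forall d, (N0 <= d)%N -> u d.+1 <= u d / 2) ->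
  forall eps, 0 < eps -> exists N, forall d, (N <= d)%N -> u d <= eps.
Proof.
move=> u0 uh eps eps0.
have uk k : u (N0 + k)%N <= u N0 / 2 ^+ k.
  elim: k => [|k IH]; first by rewrite addn0 expr0 divr1.
  rewrite addnS (le_trans (uh _ (leq_addr _ _))) // exprSr invfM mulrA.
  by rewrite ler_pM2r // invr_gt0.
have [k Hk] : exists k, u N0 / eps <= 2 ^+ k.
  exists (Num.bound (u N0 / eps)).
  have b0 : 0 <= u N0 / eps by rewrite divr_ge0 // ltW.
  apply: le_trans (ltW (archi_boundP b0)) _.
  by rewrite -natrX ler_nat; apply/ltnW/ltn_expl.
exists (N0 + k)%N => d kd.
rewrite -(subnKC (leq_trans (leq_addr k N0) kd)).
apply: le_trans (uk _) _; rewrite ler_pdivrMr ?exprn_gt0 //.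
move: Hk; rewrite ler_pdivrMr // mulrC => /le_trans; apply.
rewrite ler_pM2l // -!natrX ler_nat leq_exp2l //; lia.
Qed.

Section Abs.
Variables (R : realType) (F : finFieldType) (C : fieldType).
Variables (inF : {rmorphism F -> C}) (theta : C) (absv : C -> R).
Hypothesis hC : is_Cinf inF theta absv.

Local Notation q := #|F|.
Local Notation "a %:th" := (ev inF a theta) (at level 2, format "a %:th").

Let abs_ge0 x : 0 <= absv x := absv_ge0 hC x.
Let absM x y : absv (x * y) = absv x * absv y := absvM hC x y.

Lemma absv0 : absv 0 = 0.
Proof. exact/(absv_eq0 hC). Qed.

Lemma absv_gt0 x : x != 0 -> 0 < absv x.
Proof.
move=> x0; rewrite lt_neqAle abs_ge0 andbT eq_sym.
by apply: contra x0 => /eqP /(absv_eq0 hC) ->.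
Qed.

Lemma absv1 : absv 1 = 1.
Proof.
have n0 : absv 1 != 0 by rewrite gt_eqF // absv_gt0 // oner_neq0.
by apply: (mulfI n0); rewrite -absM !mulr1.
Qed.

Lemma absvX x n : absv (x ^+ n) = absv x ^+ n.
Proof. by elim: n => [|n IH]; rewrite ?expr0 ?absv1 // !exprS absM IH. Qed.

Lemma absvV x : absv x^-1 = (absv x)^-1.
Proof.
have [->|x0] := eqVneq x 0; first by rewrite invr0 absv0 invr0.
have ax : absv x != 0 by rewrite gt_eqF // absv_gt0.
by apply: (mulfI ax); rewrite -absM !divff // absv1.
Qed.

Lemma absvN x : absv (- x) = absv x.
Proof.
rewrite -mulN1r absM; suff -> : absv (-1) = 1 by rewrite mul1r.
apply/eqP; rewrite -(@pexpr_eq1 _ (absv (-1)) 2) // -absvX sqrrN expr1n.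
by rewrite absv1.
Qed.

Lemma absv_prod I (r : seq I) (P : pred I) (f : I -> C) :
  absv (\prod_(i <- r | P i) f i) = \prod_(i <- r | P i) absv (f i).
Proof. by elim/big_rec2: _ => [|i u v _ <-]; [exact: absv1 | exact: absM]. Qed.

Lemma absvB_le x y B : absv x <= B -> absv y <= B -> absv (x - y) <= B.
Proof.
by move=> xB yB; apply: le_trans (absvD hC _ _) _; rewrite ge_max xB absvN yB.
Qed.

Lemma absv_sum_le I (r : seq I) (P : pred I) (f : I -> C) w B : 0 < w -> 0 <= B ->
  (forall i, P i -> absv (f i) * w <= B) ->
  absv (\sum_(i <- r | P i) f i) * w <= B.
Proof.
move=> w0 B0 fB; rewrite -ler_pdivlMr //; elim/big_rec: _ => [|i u Pi uB].
  by rewrite absv0 divr_ge0 // ltW.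
apply: le_trans (absvD hC _ _) _; rewrite ge_max uB andbT ler_pdivlMr //; exact: fB.
Qed.

Lemma absv_sum_lt I (r : seq I) (P : pred I) (f : I -> C) B : 0 < B ->
  (forall i, P i -> absv (f i) < B) -> absv (\sum_(i <- r | P i) f i) < B.
Proof.
move=> B0 fB; elim/big_rec: _ => [|i u Pi uB]; first by rewrite absv0.
by apply: le_lt_trans (absvD hC _ _) _; rewrite gt_max uB fB.
Qed.

Lemma absv_dom x y : absv x < absv y -> absv (x + y) = absv y.
Proof.
move=> xy; apply/eqP; rewrite eq_le; apply/andP; split.
  by apply: le_trans (absvD hC _ _) _; rewrite ge_max lexx ltW.
rewrite leNgt; apply/negP => lt; have := absvD hC (x + y) (- x).
by rewrite addrAC subrr add0r absvN leNgt gt_max lt xy.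
Qed.

Lemma absv_domB x y : absv y < absv x -> absv (x - y) = absv x.
Proof. by move=> yx; rewrite addrC absv_dom // absvN. Qed.

Let q1 : (1 < q)%N.
Proof.
by apply/card_gt1P; exists 0, 1; split; rewrite // eq_sym oner_neq0.
Qed.

Let qR1 : 1 < (q%:R : R).
Proof. by rewrite ltr1n. Qed.

Let qR0 : 0 < (q%:R : R).
Proof. exact: lt_trans qR1. Qed.

Lemma absv_inF lam : lam != 0 -> absv (inF lam) = 1.
Proof.
move=> l0; have ax : absv (inF lam) != 0 by rewrite gt_eqF // absv_gt0 // fmorph_eq0.
apply/eqP; rewrite -(@pexpr_eq1 _ _ q.-1) //; last by have := q1; lia.
apply/eqP/(mulfI ax); rewrite mulr1 -exprS prednK ?(ltnW q1) //.
by rewrite -absvX -rmorphXn expf_card.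
Qed.

Lemma absv_inF_le lam : absv (inF lam) <= 1.
Proof.
have [->|/absv_inF-> //] := eqVneq lam 0.
by rewrite rmorph0 absv0 ler01.
Qed.

Lemma absv_ev_monic a d : a \is monic -> size a = d.+1 -> absv a%:th = q%:R ^+ d.
Proof.
move=> ma sa; rewrite (evE _ (n := d.+1)) ?sa // big_ord_recr /=.
have -> : a`_d = 1 by move/monicP: ma; rewrite lead_coefE sa.
rewrite rmorph1 mul1r absv_dom; rewrite ?absvX ?(absv_theta hC) //.
apply: absv_sum_lt => [|k _]; first by rewrite exprn_gt0.
rewrite absM absvX (absv_theta hC); apply: le_lt_trans (_ : q%:R ^+ k < _).
  by rewrite ler_piMl ?absv_inF_le // exprn_ge0 // ltW.
by rewrite ltr_eXn2l.
Qed.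

Lemma theta_transc (a : {poly F}) : a%:th = 0 -> a = 0.
Proof.
move=> a0; apply/eqP; apply: contraT => an0.
have l0 : lead_coef a != 0 by rewrite lead_coef_eq0.
have mb : (lead_coef a)^-1 *: a \is monic by rewrite monicE lead_coefZ mulVf.
have := @absv_ev_monic _ (size a).-1 mb.
rewrite size_scale ?invr_eq0 // prednK ?size_poly_gt0 // => /(_ erefl).
rewrite evZ a0 mulr0 absv0 => /eqP.
by rewrite eq_sym expf_eq0 (gt_eqF qR0) andbF.
Qed.

(** ** Limits *)

Local Notation conv := (converges absv).

Lemma convP u x : conv u x <->
  forall eps : R, 0 < eps -> exists N, forall n, (N <= n)%N -> absv (u n - x) <= eps.
Proof.
split=> [/cvgr0Pnorm_lt ux eps eps0|ux].
  have [N _ HN] := ux _ eps0; exists N => n Nn.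
  by have := HN n Nn; rewrite /= ger0_norm ?abs_ge0 // => /ltW.
apply/cvgr0Pnorm_lt => eps eps0; have [N HN] := ux _ (divr_gt0 eps0 (ltr0n _ 2)).
exists N => // n /= /HN Hn; rewrite ger0_norm ?abs_ge0 //.
by apply: le_lt_trans Hn _; rewrite ltr_pdivrMr // ltr_pMr // ltr1n.
Qed.

Lemma conv_sub u v x y : conv u x -> conv v y -> conv (fun n => u n - v n) (x - y).
Proof.
move=> /convP ux /convP vy; apply/convP => eps eps0.
have [N HN] := ux _ eps0; have [N' HN'] := vy _ eps0.
exists (maxn N N') => n; rewrite geq_max => /andP[/HN Hn /HN' Hn'].
have -> : u n - v n - (x - y) = (u n - x) - (v n - y) by ring.
exact: absvB_le.
Qed.

Lemma conv_cst x : conv (fun=> x) x.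
Proof. by apply/convP => eps eps0; exists 0%N => n _; rewrite subrr absv0 ltW. Qed.

Lemma conv_add u v x y : conv u x -> conv v y -> conv (fun n => u n + v n) (x + y).
Proof.
move=> ux vy; have := conv_sub ux (conv_sub (conv_cst 0) vy).
by rewrite sub0r opprK; under eq_fun do rewrite sub0r opprK.
Qed.

Lemma conv_bounded u x : conv u x ->
  exists2 B, 0 < B & exists N, forall n, (N <= n)%N -> absv (u n) <= B.
Proof.
move=> /convP ux; have [N HN] := ux 1 ltr01; exists (Num.max 1 (absv x)).
  by rewrite lt_max ltr01.
exists N => n /HN Hn; rewrite -[u n](subrK x).
by apply: le_trans (absvD hC _ _) _; rewrite ge_max !le_max Hn lexx !orbT.
Qed.

Lemma conv_mul u v x y : conv u x -> conv v y -> conv (fun n => u n * v n) (x * y).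
Proof.
move=> ux vy; have [B B0 [N0 HB]] := conv_bounded ux.
move/convP: ux => ux; move/convP: vy => vy; apply/convP => eps eps0.
have y0 : 0 < absv y + 1 by apply: ltr_wpDl.
have [N HN] := ux _ (divr_gt0 eps0 y0); have [N' HN'] := vy _ (divr_gt0 eps0 B0).
exists (maxn N0 (maxn N N')) => n; rewrite !geq_max => /and3P[/HB Bn /HN Hn /HN' Hn'].
have -> : u n * v n - x * y = u n * (v n - y) - (- ((u n - x) * y)) by ring.
apply: absvB_le; rewrite ?absvN absM.
  apply: le_trans (ler_pM _ _ Bn Hn') _; rewrite ?abs_ge0 //.
  by rewrite mulrC mulfVK // gt_eqF.
have yy : absv y <= absv y + 1 by rewrite ler_wpDr.
apply: le_trans (ler_pM _ _ Hn yy) _; rewrite ?abs_ge0 //.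
by rewrite mulfVK // gt_eqF.
Qed.

Lemma conv_sum I (r : seq I) (P : pred I) (u : I -> nat -> C) (x : I -> C) :
  (forall i, P i -> conv (u i) (x i)) ->
  conv (fun n => \sum_(i <- r | P i) u i n) (\sum_(i <- r | P i) x i).
Proof.
move=> ux; elim: r => [|i r IH].
  by rewrite big_nil; under eq_fun do rewrite big_nil; exact: conv_cst.
rewrite big_cons; under eq_fun do rewrite big_cons.
by case: ifP => // Pi; apply: conv_add => //; exact: ux.
Qed.

Lemma conv_eq u v x N : conv u x -> (forall n, (N <= n)%N -> u n = v n) -> conv v x.
Proof.
move=> /convP ux uv; apply/convP => eps /ux[N' HN']; exists (maxn N N') => n.
by rewrite geq_max => /andP[/uv <- /HN'].
Qed.

Lemma conv_le u x w B N : conv u x -> 0 < w -> 0 < B ->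
  (forall n, (N <= n)%N -> absv (u n) * w <= B) -> absv x * w <= B.
Proof.
move=> /convP ux w0 B0 uB; have [N' HN'] := ux _ (divr_gt0 B0 w0).
rewrite -ler_pdivlMr //; set n := maxn N N'.
have -> : x = u n - (u n - x) by ring.
apply: absvB_le; last by apply: HN'; rewrite leq_maxr.
by rewrite ler_pdivlMr // uB // leq_maxl.
Qed.

Lemma conv_unique u x y : conv u x -> conv u y -> x = y.
Proof.
move=> ux uy; apply/eqP; rewrite -subr_eq0; apply: contraT => xy.
have := conv_sub ux uy; under eq_fun do rewrite subrr.
move=> /convP H; have a0 := absv_gt0 xy.
have [N /(_ N (leqnn N))] := H _ (divr_gt0 a0 (ltr0n _ 2)).
by rewrite sub0r absvN ler_pdivlMr // ger_pMr // lern1.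
Qed.

Lemma climitE u x : conv u x -> climit absv u = x.
Proof. by move=> ux; apply: xget_unique => // y uy; apply: conv_unique uy ux. Qed.

Lemma cauchy_conv u :
  (forall eps : R, 0 < eps -> exists N, forall m n, (N <= m <= n)%N ->
     absv (u n - u m) <= eps) -> exists x, conv u x.
Proof.
move=> cu; apply: (absv_complete hC) => eps eps0.
have [N HN] := cu _ (divr_gt0 eps0 (ltr0n _ 2)).
exists N => m n Nm Nn; apply: le_lt_trans (_ : _ <= eps / 2) _.
  have [mn|/ltnW nm] := leqP m n; last by apply: HN; rewrite Nn.
  by rewrite -absvN opprB; apply: HN; rewrite Nm.
by rewrite ltr_pdivrMr // ltr_pMr // ltr1n.
Qed.

End Abs.

(** * Growth estimates *)

Lemma prod_ge1 (R : realType) (I : Type) (r : seq I) (P : pred I) (f : I -> R) :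
  (forall i, P i -> 1 <= f i) -> 1 <= \prod_(i <- r | P i) f i.
Proof. by move=> f1; elim/big_rec: _ => // i x Pi x1; rewrite mulr_ege1 // f1. Qed.

Section Growth.
Variables (R : realType) (F : finFieldType) (C : fieldType).
Variables (inF : {rmorphism F -> C}) (theta : C) (absv : C -> R).
Hypothesis hC : is_Cinf inF theta absv.
Variables (p e : nat).
Hypotheses (pC : p \in [pchar C]) (e_gt0 : (0 < e)%N) (cardF : #|F| = (p ^ e)%N).

Local Notation q := #|F|.
Local Notation "a %:th" := (ev inF a theta) (at level 2, format "a %:th").
Local Notation pw := (powersum inF theta).

Let th_transc := theta_transc hC.
Let abs_ge0 x : 0 <= absv x := absv_ge0 hC x.
Let absM x y : absv (x * y) = absv x * absv y := absvM hC x y.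
Let q1 : (1 < q)%N := q_gt1 pC e_gt0 cardF.

Let qR1 : 1 < (q%:R : R).
Proof. by rewrite ltr1n. Qed.

Let qR0 : 0 < (q%:R : R).
Proof. exact: lt_trans qR1. Qed.

Lemma absv_thX n : absv (theta ^+ n) = q%:R ^+ n.
Proof. by rewrite (absvX hC) (absv_theta hC). Qed.

Lemma absv_thB m n : (n < m)%N -> absv (theta ^+ m - theta ^+ n) = q%:R ^+ m.
Proof. by move=> nm; rewrite (absv_domB hC) !absv_thX // ltr_eXn2l. Qed.

Lemma absv_lc d : absv (lc F theta d) = \prod_(i < d) q%:R ^+ (q ^ i.+1).
Proof.
elim: d => [|d IH]; first by rewrite /lc big_geq // (absv1 hC) big_ord0.
rewrite lcS absM IH big_ord_recr /=; congr (_ * _).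
rewrite -(absvN hC) opprB -{2}[theta]expr1 absv_thB //.
by rewrite -(expn0 q) ltn_exp2l.
Qed.

Lemma absv_lc_ge1 d : 1 <= absv (lc F theta d).
Proof. by rewrite absv_lc; apply: prod_ge1 => i _; rewrite exprn_ege1 // ltW. Qed.

Lemma absv_Dc_ge1 d : 1 <= absv (Dc F theta d).
Proof.
rewrite (absv_prod hC); apply: prod_ge1 => i _.
by rewrite absv_thB ?exprn_ege1 ?ltW // ltn_exp2l.
Qed.

Lemma absv_carlitz_coef i j : absv (carlitz_coef F theta i j) <= 1.
Proof.
rewrite /carlitz_coef; case: ifP => _; last by rewrite (absv0 hC) ler01.
rewrite absM !(absvV hC) (absvX hC) mulr_ile1 ?invr_ge0 ?exprn_ge0 //.
  by rewrite invf_le1 ?absv_Dc_ge1 // (lt_le_trans ltr01) // absv_Dc_ge1.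
rewrite invf_le1 ?exprn_ege1 ?absv_lc_ge1 //.
by rewrite exprn_gt0 // (lt_le_trans ltr01) // absv_lc_ge1.
Qed.

(** As [carlitz d] is 1 on the monic polynomials of degree [d], each summand may be
multiplied by it; this expresses the power sum through power sums with smaller
exponents, with coefficients of absolute value at most 1. *)
Lemma absv_powersum d n : (0 < n)%N -> absv (pw d n) <= absv (pw d 1).
Proof.
have [N] := ubnP n; elim: N n => // N IH [|[|n]] // ltn _.
have -> : pw d n.+2 = \sum_(m < n.+2) (carlitz_poly F theta d)`_m * pw d (n.+2 - m).
  rewrite -(powersum_reduce pC e_gt0 cardF th_transc) //.
    rewrite powersumE; apply: eq_monicsum => a ma sa.
    by rewrite horner_carlitz (carlitz_ev_monic pC e_gt0 cardF th_transc) // mulr1.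
  by rewrite (size_carlitz pC e_gt0 cardF th_transc); lia.
rewrite -[X in X <= _]mulr1; apply: (absv_sum_le hC) => // m _; rewrite mulr1.
case: m => [[|m] ltm] /=.
  by rewrite (coef_carlitz0 theta pC e_gt0 cardF) mul0r (absv0 hC).
rewrite absM; apply: le_trans (_ : 1 * absv (pw d (n.+2 - m.+1)) <= _).
  apply: ler_wpM2r => //.
  have := @absv_sum_le _ _ _ _ _ _ hC.
  rewrite (coef_carlitz theta pC e_gt0 cardF d (j := m.+1)); last exact: ltn_expl.
  move=> /(_ _ _ _ _ 1 1 ltr01 ler01) H; rewrite -[X in X <= _]mulr1; apply: H => l _.
  rewrite mulr1 absM; case: eqP => _; last by rewrite (absv0 hC) mulr0.
  by rewrite (absv1 hC) mulr1 absv_carlitz_coef.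
by rewrite mul1r; apply: IH; lia.
Qed.

(** The Gauss norm of [nbasis d] on the disc of radius [rho]. *)
Definition nbound (rho : R) d : R := \prod_(i < d) Num.max rho (q%:R ^+ (q ^ i)).

Lemma nbound_ge1 rho d : 1 <= rho -> 1 <= nbound rho d.
Proof. by move=> r1; apply: prod_ge1 => i _; rewrite le_max r1. Qed.

Lemma absv_nbasis rho d t : absv t <= rho -> absv (nbasis F theta d t) <= nbound rho d.
Proof.
move=> tr; rewrite /nbasis (absv_prod hC); apply: ler_prod => i _.
rewrite abs_ge0; apply: (absvB_le hC); first by rewrite le_max tr.
by rewrite absv_thX le_max lexx orbT.
Qed.

(** A bound, independent of the weight, for all letters of index [d] on the
polydisc of radius [rho]. *)
Definition tail rho d : R := absv (pw d 1) * nbound rho d ^+ q.-1.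

Let tail_ge0 rho d : 1 <= rho -> 0 <= tail rho d.
Proof. by move=> r1; rewrite mulr_ge0 // exprn_ge0 // (le_trans ler01) // nbound_ge1. Qed.

Let tailS rho d : tail rho d.+1 =
  tail rho d * ((q%:R ^+ (q ^ d.+1))^-1 * Num.max rho (q%:R ^+ (q ^ d)) ^+ q.-1).
Proof.
rewrite /tail !(powersum1 pC e_gt0 cardF th_transc) /carlitz_coef !leq0n !expn0 !subn0.
rewrite /Dc !big_ord0 invr1 !mul1r !expr1 !(absvV hC) !absv_lc /nbound !big_ord_recr /=.
by rewrite invfM exprMn; ring.
Qed.

(** With at most [q - 1] variables the power sum wins over the Newton basis: for
large [d] the quotient of consecutive terms is exactly [q ^- (q ^ d)]. *)
Let tail_half rho : 1 <= rho -> exists N0, forall d, (N0 <= d)%N ->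
  tail rho d.+1 <= tail rho d / 2.
Proof.
move=> r1; exists (Num.bound rho) => d Nd.
rewrite tailS; apply: ler_wpM2l; first exact: tail_ge0.
have rq : rho <= q%:R ^+ (q ^ d).
  apply: le_trans (ltW (archi_boundP (le_trans ler01 r1))) _.
  rewrite -natrX ler_nat; apply: leq_trans Nd _.
  by apply: leq_trans (ltnW (ltn_expl d q1)) _; apply/ltnW/ltn_expl.
have -> : Num.max rho (q%:R ^+ (q ^ d)) = q%:R ^+ (q ^ d) by apply/max_idPr.
have -> : (q ^ d.+1 = q ^ d + q ^ d * q.-1)%N.
  by rewrite expnSr -mulnS prednK // ltnW.
rewrite exprD invfM -exprM mulfVK ?gt_eqF ?exprn_gt0 //.
rewrite lef_pV2 ?posrE ?exprn_gt0 //.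
rewrite -natrX ler_nat; apply: leq_trans q1 _.
by rewrite -{1}(expn1 q) leq_exp2l // expn_gt0 ltnW.
Qed.

Lemma tail_to0 rho eps : 1 <= rho -> 0 < eps -> exists N, forall d, (N <= d)%N -> tail rho d <= eps.
Proof.
move=> r1; have [N0 HN] := tail_half r1.
by apply: (halving_to0 (N0 := N0)) => // d; exact: tail_ge0.
Qed.

Lemma tail_bounded rho : 1 <= rho -> exists2 B, 1 <= B & forall d, tail rho d <= B.
Proof.
move=> r1; have [N HN] := tail_to0 r1 ltr01.
have s0 : 0 <= \sum_(i < N) tail rho i by apply: sumr_ge0 => i _; exact: tail_ge0.
exists (1 + \sum_(i < N) tail rho i); first by rewrite lerDl.
move=> d; have [Nd|dN] := leqP N d.
  by apply: le_trans (HN _ Nd) _; rewrite lerDl.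
rewrite (bigD1 (Ordinal dN)) //= addrCA lerDl addr_ge0 //.
by apply: sumr_ge0 => i _; exact: tail_ge0.
Qed.

(** ** Iterated sums *)

Variable I : finType.
Hypothesis cardI : (#|I| < q)%N.
Implicit Types (y : I -> nat -> C) (w : I -> R) (M : seq ({set I} * nat)).

Definition weight w M : R := \prod_(c <- M) \prod_(k in c.1) w k.

Let weight_gt0 w M : (forall k, 0 < w k) -> 0 < weight w M.
Proof. by move=> w0; apply: prodr_gt0 => c _; apply: prodr_gt0. Qed.

Definition tame (rho : R) y w : Prop :=
  (forall k, 0 < w k) /\ forall k d, absv (y k d) * w k <= nbound rho d.

Let letter_bound rho y w (U : {set I}) n d : 1 <= rho -> tame rho y w -> (0 < n)%N ->
  absv (pw d n * \prod_(k in U) y k d) * \prod_(k in U) w k <= tail rho d.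
Proof.
move=> r1 [w0 yw] n0; rewrite absM (absv_prod hC) -mulrA -big_split /=.
apply: ler_pM => //; last first.
- apply: le_trans (_ : \prod_(k in U) nbound rho d <= _).
    apply: ler_prod => k _; rewrite yw mulr_ge0 // ltW //.
  rewrite prodr_const ler_weXn2l ?nbound_ge1 //.
  by rewrite -ltnS prednK ?(ltnW q1) //; apply: leq_ltn_trans cardI; exact: max_card.
- exact: absv_powersum.
- by apply: prodr_ge0 => k _; rewrite mulr_ge0 // ltW.
Qed.

Lemma nestY_bound rho M : 1 <= rho -> all (fun c => 0 < c.2)%N M ->
  exists2 B, 1 <= B & forall y w D, tame rho y w -> absv (nestY pw y M D) * weight w M <= B.
Proof.
move=> r1; elim: M => [|c M IH] /=.
  by exists 1 => // y w D _; rewrite /weight big_nil mulr1 /nestY /= (absv1 hC).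
case/andP=> c0 /IH[B B1 HB]; have [B' B'1 HB'] := tail_bounded r1.
exists (B' * B); first by rewrite mulr_ege1.
move=> y w D yw; apply: (absv_sum_le hC).
- by apply: weight_gt0; case: yw.
- by rewrite mulr_ge0 // (le_trans ler01).
move=> d _; rewrite absM /weight big_cons mulrACA; apply: ler_pM.
- by rewrite mulr_ge0 // prodr_ge0 // => k _; case: yw => w0 _; exact: ltW.
- by rewrite mulr_ge0 // ltW // weight_gt0 //; case: yw.
- by apply: le_trans (HB' d); apply: letter_bound.
- exact: HB.
Qed.

(** The estimate is uniform in [y] and [w], so that it applies at once to
values, to Newton coefficients and to Taylor coefficients. *)
Lemma nestY_cauchy rho M eps : 1 <= rho -> all (fun c => 0 < c.2)%N M -> 0 < eps ->
  exists N, forall y w D D', tame rho y w -> (N <= D <= D')%N ->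
    absv (nestY pw y M D' - nestY pw y M D) * weight w M <= eps.
Proof.
move=> r1; case: M => [|c M] M0 eps0.
  by exists 0%N => y w D D' _ _; rewrite /nestY /= subrr (absv0 hC) mul0r ltW.
move: M0 => /= /andP[c0 M0].
have [B B1 HB] := nestY_bound r1 M0.
have B0 : 0 < B by apply: lt_le_trans B1.
have [N HN] := tail_to0 r1 (divr_gt0 eps0 B0).
exists N => y w D D' yw /andP[ND DD'].
rewrite /nestY /= -!(big_mkord xpredT (fun d =>
   pw d c.2 * (\prod_(k in c.1) y k d) * nest _ M d)).
rewrite (big_cat_nat (n := D)) //= addrAC subrr add0r big_nat.
apply: (absv_sum_le hC).
- by apply: weight_gt0; case: yw.
- exact: ltW.
move=> d /andP[Dd _]; rewrite absM /weight big_cons mulrACA.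
rewrite -(divfK (lt0r_neq0 B0) eps); apply: ler_pM.
- by rewrite mulr_ge0 // prodr_ge0 // => k _; case: yw => w0 _; exact: ltW.
- by rewrite mulr_ge0 // ltW // weight_gt0 //; case: yw.
- by apply: le_trans (HN d (leq_trans ND Dd)); apply: letter_bound.
- exact: HB.
Qed.

Lemma prod_weights M n w : wtype M [set: I]%SET n ->
  \prod_(c <- M) \prod_(k in c.1) w k = \prod_k w k.
Proof.
move=> /wtype_index[J HJ]; rewrite big_tnth.
exact: (prod_index (fun k _ => w k) HJ).
Qed.

End Growth.

(** * Newton and Taylor expansions *)

Section Expansions.
Variables (R : realType) (F : finFieldType) (C : fieldType).
Variables (inF : {rmorphism F -> C}) (theta : C) (absv : C -> R).
Hypothesis hC : is_Cinf inF theta absv.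
Variables (p e : nat).
Hypotheses (pC : p \in [pchar C]) (e_gt0 : (0 < e)%N) (cardF : #|F| = (p ^ e)%N).
Variable S : {fset Npos}.
Hypothesis cardS : (#|{: S}| < #|F|)%N.

Local Notation q := #|F|.
Local Notation pw := (powersum inF theta).
Local Notation b := (nbasis F theta).
Local Notation conv := (converges absv).
Local Notation T := (S -> C).

Let th_transc := theta_transc hC.
Let abs_ge0 x : 0 <= absv x := absv_ge0 hC x.
Let absM x y : absv (x * y) = absv x * absv y := absvM hC x y.
Let q1 : (1 < q)%N := q_gt1 pC e_gt0 cardF.

(** By induction on [d]: in the new factor, [theta^(q^j) - theta^(q^i)] lowers [i]
by [carlitz_coef_step], and [theta^(q^i) - theta^(q^d)] is constant in [j]. *)
Lemma nbasis_dual d i :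
  \sum_(j < i.+1) carlitz_coef F theta i j * b d (theta ^+ (q ^ j)) = (d == i)%:R.
Proof.
elim: d i => [|d IH] i.
  transitivity (carlitz F theta i 1).
    by apply: eq_bigr => j _; rewrite /nbasis big_ord0 expr1n.
  case: i => [|i]; first exact: carlitz_0.
  by rewrite (carlitz_one pC e_gt0 cardF th_transc).
case: i => [|i].
  by rewrite big_ord1 /nbasis big_ord_recl expn0 subrr mul0r mulr0.
have -> : \sum_(j < i.+2) carlitz_coef F theta i.+1 j * b d.+1 (theta ^+ (q ^ j)) =
    \sum_(j < i.+2) (carlitz_coef F theta i.+1 j * (theta ^+ (q ^ j) - theta ^+ (q ^ i.+1))
       * b d (theta ^+ (q ^ j)))
    + (theta ^+ (q ^ i.+1) - theta ^+ (q ^ d)) *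
      \sum_(j < i.+2) carlitz_coef F theta i.+1 j * b d (theta ^+ (q ^ j)).
  rewrite mulr_sumr -big_split /=; apply: eq_bigr => j _.
  by rewrite nbasisS; ring.
rewrite IH big_ord_recr /= subrr mulr0 mul0r addr0.
under eq_bigr => j _ do rewrite (carlitz_coef_step pC e_gt0 cardF th_transc) ?(ltnW (ltn_ord j)) //.
rewrite IH eqSS; case: (eqVneq d i.+1) => [->|_]; first by rewrite subrr mul0r addr0.
by rewrite mulr0 addr0.
Qed.

Lemma Fcoef_newton (d i : {ffun S -> nat}) :
  Fcoef F theta (fun t => \prod_k b (d k) (t k)) i = \prod_k (d k == i k)%:R.
Proof.
transitivity (\sum_(j : {dffun forall k : S, 'I_(i k).+1}) \prod_k
    (b (d k) (theta ^+ (q ^ j k)) *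
     ((Dc F theta (j k))^-1 * lc F theta (i k - j k) ^- (q ^ j k)))).
  by apply: eq_bigr => j _; rewrite [RHS]big_split.
rewrite (prod_sum_dffun _ (fun k l => b (d k) (theta ^+ (q ^ l)) *
  ((Dc F theta l)^-1 * lc F theta (i k - l) ^- (q ^ l)))).
apply: eq_bigr => k _; rewrite -nbasis_dual; apply: eq_bigr => l _.
by rewrite mulrC /carlitz_coef -ltnS ltn_ord.
Qed.

Lemma FcoefB (f g : CS_fun C S) i :
  Fcoef F theta (f - g) i = Fcoef F theta f i - Fcoef F theta g i.
Proof. by rewrite /Fcoef -sumrB; apply: eq_bigr => j _; rewrite -mulrBl. Qed.

Lemma FcoefZ a (f : CS_fun C S) i : Fcoef F theta (a *: f) i = a * Fcoef F theta f i.
Proof. by rewrite /Fcoef mulr_sumr; apply: eq_bigr => j _; rewrite mulrA. Qed.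

Lemma Fcoef_sum I (r : seq I) (f : I -> CS_fun C S) i :
  Fcoef F theta (\sum_(j <- r) f j) i = \sum_(j <- r) Fcoef F theta (f j) i.
Proof.
elim: r => [|j r IH]; first by rewrite !big_nil /Fcoef big1 // => k _; rewrite mul0r.
rewrite !big_cons -IH /Fcoef -big_split /=.
by apply: eq_bigr => k _; rewrite -mulrDl.
Qed.

Lemma Fcoef_conv (u : nat -> T -> C) (f : T -> C) i :
  (forall t, conv (fun D => u D t) (f t)) ->
  conv (fun D => Fcoef F theta (u D) i) (Fcoef F theta f i).
Proof.
move=> uf; apply: (conv_sum hC) => j _; apply: (conv_mul hC) => //.
exact: (conv_cst hC).
Qed.

Definition vals D (i : {ffun S -> 'I_D}) : {ffun S -> nat} := [ffun k => (i k : nat)].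

(** The Cauchy condition is imposed with weights that depend on a radius [rho]. For
Newton coefficients it controls the values on the polydisc of this radius, for
Taylor coefficients the Gauss norm. *)
Definition expansion (phi : nat -> C -> C) (wt : R -> nat -> R)
    (u : nat -> T -> C) (c : nat -> {ffun S -> nat} -> C) : Prop :=
  [/\ forall D t, u D t =
        \sum_(i : {ffun S -> 'I_D}) c D (vals i) * \prod_k phi (i k) (t k),
      forall D (i : {ffun S -> nat}) k, (D <= i k)%N -> c D i = 0
    & forall rho eps, 1 <= rho -> 0 < eps -> exists N, forall D D' (i : {ffun S -> nat}),
        (N <= D <= D')%N -> absv (c D' i - c D i) * \prod_k wt rho (i k) <= eps].

Definition newton := expansion b (@nbound R F).
Definition taylor := expansion (fun n t => t ^+ n) (fun (rho : R) n => rho ^+ n).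

Lemma expansion0 phi wt : expansion phi wt 0 (fun _ _ => 0).
Proof.
split=> // [D t|rho eps _ eps0]; first by rewrite big1 // => i _; rewrite mul0r.
by exists 0%N => D D' i _; rewrite subr0 (absv0 hC) mul0r ltW.
Qed.

Lemma expansionB phi wt u v c c' : (forall rho n, 1 <= rho -> 0 < wt rho n) ->
  expansion phi wt u c -> expansion phi wt v c' ->
  expansion phi wt (u - v) (fun D i => c D i - c' D i).
Proof.
move=> wt0 [uE u0 uc] [vE v0 vc]; split.
- move=> D t; rewrite -[LHS]/(u D t - v D t) uE vE -sumrB.
  by apply: eq_bigr => i _; rewrite mulrBl.
- by move=> D i k Dk; rewrite (u0 _ _ _ Dk) (v0 _ _ _ Dk) subrr.
move=> rho eps r1 eps0; have [N HN] := uc _ _ r1 eps0; have [N' HN'] := vc _ _ r1 eps0.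
exists (maxn N N') => D D' i /andP[]; rewrite geq_max => /andP[ND N'D] DD'.
have w0 : 0 < \prod_k wt rho (i k) by apply: prodr_gt0 => k _; exact: wt0.
rewrite -ler_pdivlMr //.
have -> : c D' i - c' D' i - (c D i - c' D i) = (c D' i - c D i) - (c' D' i - c' D i) by ring.
by apply: (absvB_le hC); rewrite ler_pdivlMr // ?HN ?HN' // ?ND ?N'D.
Qed.

Lemma nestY_eq0 M n (y : S -> nat -> C) D k : wtype M [set: S]%SET n ->
  (forall d, (d < D)%N -> y k d = 0) -> nestY pw y M D = 0.
Proof.
move=> /wtype_index[J HJ] yk; rewrite (nestY_tuple _ _ _ HJ) big1 // => a _.
by rewrite (bigD1 k) //= yk ?ltn_ord // mul0r mulr0.
Qed.

Local Notation lL := (lambda_letter inF theta (fun (k : S) (t : T) => t k)).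

Lemma wsum_lambda M D t : wsum lL M D t = nestY pw (fun k d => b d (t k)) M D.
Proof.
rewrite wsum_nest; apply: eq_nest => c d _ _; exact: lambda_letterE.
Qed.

Definition ncoef M (D : nat) (m : {ffun S -> nat}) : C :=
  nestY pw (fun k d => (m k == (q ^ d)%N)%:R) M D.

Definition qpow (i : {ffun S -> nat}) : {ffun S -> nat} := [ffun k => (q ^ i k)%N].

Lemma nbound_gt0 (rho : R) n : 1 <= rho -> 0 < nbound F rho n.
Proof. by move=> r1; apply: lt_le_trans ltr01 _; exact: nbound_ge1. Qed.

Lemma newton_wsum M n : wtype M [set: S]%SET n ->
  newton (wsum lL M) (fun D i => ncoef M D (qpow i)).
Proof.
move=> HM; have [M0 _ _] := HM.
have qE (k : S) (i : {ffun S -> nat}) d : (qpow i k == (q ^ d)%N) = (i k == d).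
  by rewrite ffunE eqn_exp2l.
split.
- move=> D t; rewrite wsum_lambda (nestY_expand pw (z := fun k i d => (i == d)%:R)
    (phi := fun k i => b i (t k)) HM); last first.
    move=> k d dD; rewrite (bigD1 (Ordinal dD)) //= eqxx mul1r big1 ?addr0 // => i.
    by rewrite -val_eqE /= => /negbTE->; rewrite mul0r.
  apply: eq_bigr => i _; congr (_ * _); apply: eq_nest => c d _ _; congr (_ * _).
  by apply: eq_bigr => k _; rewrite qE /vals ffunE.
- move=> D i k Dk; apply: (nestY_eq0 (k := k) HM) => d dD.
  by rewrite qE gtn_eqF // (leq_trans dD).
move=> rho eps r1 eps0.
have [N HN] := nestY_cauchy hC pC e_gt0 cardF cardS r1 M0 eps0.
exists N => D D' i DD'; have := HN (fun k d => (qpow i k == (q ^ d)%N)%:R)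
  (fun k => nbound F rho (i k)) D D' _ DD'.
rewrite /weight (prod_weights _ HM); apply; split=> [k|k d]; first exact: nbound_gt0.
rewrite qE; case: eqP => [->|_]; first by rewrite (absv1 hC) mul1r.
by rewrite (absv0 hC) mul0r ltW // nbound_gt0.
Qed.

Let bpoly d : {poly C} := \prod_(j < d) ('X - (theta ^+ (q ^ j))%:P).

Let size_bpoly d : size (bpoly d) = d.+1.
Proof. by rewrite size_prod_XsubC /index_enum -enumT size_enum_ord. Qed.

Let horner_bpoly d t : (bpoly d).[t] = b d t.
Proof. by rewrite horner_prod; apply: eq_bigr => j _; rewrite hornerXsubC. Qed.

Let coef_bpoly rho d m : 1 <= rho -> absv (bpoly d)`_m * rho ^+ m <= nbound F rho d.
Proof.
move=> r1; have r0 : 0 < rho by apply: lt_le_trans r1.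
elim: d m => [|d IH] m.
  rewrite /bpoly /nbound !big_ord0 coef1; case: m => [|m] /=.
    by rewrite (absv1 hC) mul1r.
  by rewrite (absv0 hC) mul0r ler01.
rewrite /bpoly /nbound !big_ord_recr /= -/(bpoly d) -/(nbound F rho d).
rewrite mulrBr coefB coefMX coefMC -ler_pdivlMr ?exprn_gt0 //.
apply: (absvB_le hC); rewrite ler_pdivlMr ?exprn_gt0 //.
  case: m => [|m] /=; first by rewrite (absv0 hC) mul0r mulr_ge0 ?ltW ?nbound_gt0 // lt_max r0.
  rewrite exprSr mulrA; apply: ler_pM => //; first by rewrite mulr_ge0 // exprn_ge0 // ltW.
    exact: ltW.
  by rewrite le_max lexx.
rewrite absM mulrAC; apply: ler_pM => //; first by rewrite mulr_ge0 // exprn_ge0 // ltW.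
by rewrite (absv_thX hC) le_max lexx orbT.
Qed.

Lemma taylor_wsum M n : wtype M [set: S]%SET n -> exists c, taylor (wsum lL M) c.
Proof.
move=> HM; have [M0 _ _] := HM.
exists (fun D m => nestY pw (fun k d => (bpoly d)`_(m k)) M D); split.
- move=> D t; rewrite wsum_lambda (nestY_expand pw (z := fun k i d => (bpoly d)`_i)
    (phi := fun k i => t k ^+ i) HM); last first.
    by move=> k d dD; rewrite -horner_bpoly (@horner_coef_wide _ D) // size_bpoly.
  apply: eq_bigr => i _; congr (_ * _); apply: eq_nest => c d _ _; congr (_ * _).
  by apply: eq_bigr => k _; rewrite /vals ffunE.
- move=> D i k Dk; apply: (nestY_eq0 (k := k) HM) => d dD.
  by rewrite nth_default // size_bpoly (leq_trans dD).
move=> rho eps r1 eps0.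
have [N HN] := nestY_cauchy hC pC e_gt0 cardF cardS r1 M0 eps0.
exists N => D D' i DD'; have := HN (fun k d => (bpoly d)`_(i k))
  (fun k => rho ^+ i k) D D' _ DD'.
rewrite /weight (prod_weights _ HM); apply; split=> [k|k d]; last exact: coef_bpoly.
by rewrite exprn_gt0 // (lt_le_trans ltr01).
Qed.

Let radius (t : T) : R := 1 + \sum_k absv (t k).

Let radius_ge1 t : 1 <= radius t.
Proof. by rewrite lerDl sumr_ge0. Qed.

Let radiusP t k : absv (t k) <= radius t.
Proof.
rewrite /radius (bigD1 k) //= addrCA lerDl addr_ge0 //.
by apply: sumr_ge0.
Qed.

Definition pconv (u : nat -> T -> C) (f : T -> C) := forall t, conv (fun D => u D t) (f t).

Lemma pconvB u v f g : pconv u f -> pconv v g -> pconv (u - v) (f - g).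
Proof. by move=> uf vg t; apply: (conv_sub hC). Qed.

Lemma pconv0 : pconv 0 0.
Proof. move=> t; exact: (conv_cst hC). Qed.

Lemma pconv_unique u f g : pconv u f -> pconv u g -> f = g.
Proof. by move=> uf ug; apply/funext => t; apply: (conv_unique hC). Qed.

Lemma words_pconv U n u : words lL U n u -> exists f, pconv u f.
Proof.
elim=> {u} [u [M [M0 _ _] ->]||u v _ [f uf] _ [g vg]]; last 2 first.
- by exists 0; exact: pconv0.
- by exists (f - g); exact: pconvB.
suff H t : exists x, conv (fun D => wsum lL M D t) x.
  by have [f Hf] := boolp.choice H; exists f.
apply: (cauchy_conv hC) => eps eps0.
have [N HN] := nestY_cauchy hC pC e_gt0 cardF cardS (radius_ge1 t) M0 eps0.
exists N => m n' mn; rewrite !wsum_lambda.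
have := HN (fun k d => b d (t k)) (fun=> 1) _ _ _ mn.
rewrite /weight big1 ?mulr1 => [|c _]; last by rewrite big1.
apply; split=> [k|k d]; first exact: ltr01.
by rewrite mulr1; apply: (absv_nbasis hC); exact: radiusP.
Qed.

(** Elements of the graded sum over all weights: entireness and injectivity are
claims about the whole sum. *)
Definition full_words : (nat -> T -> C) -> Prop :=
  zspan (fun u => exists n, words lL [set: S]%SET n u).

Lemma full_words_newton u : full_words u -> exists c, newton u c.
Proof.
have wt0 rho n : 1 <= rho -> 0 < nbound F rho n := @nbound_gt0 rho n.
elim=> {u} [u [n]||u v _ [c uc] _ [c' vc]]; last 2 first.
- by exists (fun _ _ => 0); exact: expansion0.
- by exists (fun D i => c D i - c' D i); exact: expansionB.
elim=> {u} [u [M HM ->]||u v _ [c uc] _ [c' vc]].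
- by exists (fun D i => ncoef M D (qpow i)); exact: newton_wsum HM.
- by exists (fun _ _ => 0); exact: expansion0.
- by exists (fun D i => c D i - c' D i); exact: expansionB.
Qed.

Lemma full_words_taylor u : full_words u -> exists c, taylor u c.
Proof.
have wt0 (rho : R) n : 1 <= rho -> 0 < rho ^+ n.
  by move=> r1; rewrite exprn_gt0 // (lt_le_trans ltr01).
elim=> {u} [u [n]||u v _ [c uc] _ [c' vc]]; last 2 first.
- by exists (fun _ _ => 0); exact: expansion0.
- by exists (fun D i => c D i - c' D i); exact: expansionB.
elim=> {u} [u [M HM ->]||u v _ [c uc] _ [c' vc]].
- exact: taylor_wsum HM.
- by exists (fun _ _ => 0); exact: expansion0.
- by exists (fun D i => c D i - c' D i); exact: expansionB.
Qed.

(** Each coefficient of the map involves finitely many values, hence is continuous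
for pointwise convergence; on the polynomial [u D] it reads off a Newton
coefficient. *)
Lemma newton_Fcoef u c f i : newton u c -> pconv u f ->
  conv (fun D => c D i) (Fcoef F theta f i).
Proof.
move=> [uE _ _] uf; apply: (conv_eq hC (N := (\max_k i k).+1) (Fcoef_conv i uf)) => D Di.
have iD k : (i k < D)%N by apply: leq_trans Di; rewrite ltnS leq_bigmax.
have -> : u D = \sum_(j : {ffun S -> 'I_D})
    c D (vals j) *: ((fun t => \prod_k b (vals j k) (t k)) : CS_fun C S).
  apply/funext => t; rewrite uE sum_app; apply: eq_bigr => j _.
  by congr (_ * _); apply: eq_bigr => k _; rewrite ffunE.
rewrite Fcoef_sum.
pose i' : {ffun S -> 'I_D} := [ffun k => Ordinal (iD k)].
have vi : vals i' = i by apply/ffunP => k; rewrite !ffunE.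
rewrite (bigD1 i') //= FcoefZ Fcoef_newton vi big1 ?mulr1 => [|k _]; last by rewrite eqxx.
rewrite big1 ?addr0 // => j ji; rewrite FcoefZ Fcoef_newton.
have [k jk] : exists k, j k != i' k.
  apply/existsP; rewrite -negb_forall; apply: contra ji => /forallP H.
  by apply/eqP/ffunP => k; apply/eqP.
rewrite (bigD1 k) //= !ffunE (_ : (j k == i k :> nat) = false) ?mul0r ?mulr0 //.
by apply/negbTE; apply: contra jk => /eqP jk; apply/eqP/val_inj; rewrite ffunE.
Qed.

(** The coefficients [c D] tend to those of [f], which are zero, uniformly in the
weighted norms, so that [u D] tends to 0. A general entire function does not have
this property: the infinite product of the [1 - t / theta^(q^j)] is nonzero, and
all its Newton coefficients vanish. *)
Lemma newton_inj u c f : newton u c -> pconv u f ->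
  (forall i, Fcoef F theta f i = 0) -> f = 0.
Proof.
move=> uc uf f0; apply/funext => t; apply: (conv_unique hC (uf t)).
have cf i := newton_Fcoef i uc uf; case: uc => uE _ uc.
apply/(convP hC) => eps eps0.
have [N HN] := uc _ _ (radius_ge1 t) eps0.
exists N => D ND; rewrite subr0 uE -[X in X <= _]mulr1.
apply: (absv_sum_le hC) => // [|i _]; first exact: ltW.
rewrite mulr1 absM (absv_prod hC).
apply: le_trans (_ : absv (c D (vals i)) * \prod_k nbound F (radius t) (vals i k) <= _).
  apply: ler_wpM2l => //; apply: ler_prod => k _; rewrite abs_ge0 ffunE.
  by apply: (absv_nbasis hC); exact: radiusP.
apply: (conv_le hC (u := fun D' => c D (vals i) - c D' (vals i)) (N := D)) => //.
- have := conv_sub hC (conv_cst hC (c D (vals i))) (cf (vals i)).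
  by rewrite f0 subr0.
- by apply: prodr_gt0 => k _; apply: nbound_gt0.
- by move=> D' DD'; rewrite -(absvN hC) opprB; apply: HN; rewrite ND.
Qed.

(** The limits [cl] of the Taylor coefficients are uniformly close, in each weighted
norm, to the finitely supported families [c N]. *)
Lemma taylor_entire u c f : taylor u c -> pconv u f -> entire absv S f.
Proof.
move=> [uE u0 uc] uf.
have H i : exists x, conv (fun D => c D i) x.
  apply: (cauchy_conv hC) => eps eps0; have [N HN] := uc 1 _ (lexx 1) eps0.
  exists N => m n mn; have := HN m n i mn.
  by rewrite big1 ?mulr1 // => k _; rewrite expr1n.
have [cl Hcl] := boolp.choice H.
have tail rho eps : 1 <= rho -> 0 < eps -> exists N, forall D i, (N <= D)%N ->
    absv (cl i - c D i) * \prod_k rho ^+ i k <= eps.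
  move=> r1 eps0; have [N HN] := uc _ _ r1 eps0; exists N => D i ND.
  apply: (conv_le hC (u := fun D' => c D' i - c D i) (N := D)) => //.
  - by apply: (conv_sub hC) => //; exact: (conv_cst hC).
  - by apply: prodr_gt0 => k _; rewrite exprn_gt0 // (lt_le_trans ltr01).
  - by move=> D' DD'; apply: HN; rewrite ND.
exists cl; split.
  move=> rho eps rho0 eps0.
  have r1 : 1 <= Num.max 1 rho by rewrite le_max lexx.
  have [N HN] := tail _ _ r1 (divr_gt0 eps0 (ltr0n _ 2)).
  apply: (@sub_finite_set _ _ (range (@vals N))); last exact: finite_image.
  move=> al /= Hal.
  have alN k : (al k < N)%N.
    rewrite ltnNge; apply/negP => Nk.
    have := HN N al (leqnn N); rewrite (u0 _ _ _ Nk) subr0 => Hle.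
    have : eps <= eps / 2.
      apply: le_trans Hal (le_trans _ Hle); apply: ler_wpM2l => //.
      rewrite -prodrXr; apply: ler_prod => j _.
      apply/andP; split; first by rewrite exprn_ge0 // ltW.
      apply: lerXn2r; rewrite ?nnegrE.
      - exact: ltW.
      - exact: le_trans ler01 r1.
      - by rewrite le_max lexx orbT.
    by rewrite ler_pdivlMr // ger_pMr // lern1.
  exists [ffun k => Ordinal (alN k)] => //.
  by apply/ffunP => k; rewrite !ffunE.
move=> t; rewrite -[f t]addr0.
have := @conv_add _ _ _ _ _ _ hC _ _ _ 0 (uf t).
move=> /(_ (fun N => \sum_(al : {ffun S -> 'I_N})
  (cl (vals al) - c N (vals al)) * \prod_k t k ^+ al k)) H1.
apply: (conv_eq hC (N := 0%N)) (H1 _) _ => [|N _]; last first.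
  rewrite uE -big_split /=; apply: eq_bigr => al _.
  by rewrite -mulrDl addrC subrK.
apply/(convP hC) => eps eps0; have [N HN] := tail _ _ (radius_ge1 t) eps0.
exists N => D ND; rewrite subr0 -[X in X <= _]mulr1.
apply: (absv_sum_le hC) => // [|al _]; first exact: ltW.
rewrite mulr1 absM (absv_prod hC); apply: le_trans (HN D (vals al) ND).
apply: ler_wpM2l => //; apply: ler_prod => k _; rewrite abs_ge0 ffunE (absvX hC).
by apply: lerXn2r; rewrite ?nnegrE // (le_trans ler01).
Qed.

End Expansions.

(** * Composition arrays as words *)

Section Arrays.
Variable S : {fset Npos}.

Definition column (c : fmaps * nat) : {set S} * nat :=
  ([set k : S | (0 < c.1 (val k))%N]%SET, c.2).

(** An array that is admissible for a finite set has entries 0 and 1, so that a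
column is determined by the set of its variables. *)
Lemma array_word (U : {set S}) Sigma n M :
  admissible Sigma n M -> (forall k : S, Sigma (val k) = (k \in U)) ->
  wtype (map column M) U n /\
  forall c (k : S), c \in M -> c.1 (val k) = (k \in (column c).1).
Proof.
case=> M0 MS Mn SU.
have cE c (k : S) : c \in M -> c.1 (val k) = (k \in (column c).1).
  move=> cM; rewrite finset.inE; have := MS (val k); rewrite SU.
  rewrite (perm_big _ (perm_to_rem cM)) big_cons.
  by case: (k \in U); case: (c.1 (val k)) => [|[|m]].
split=> //; split.
- by apply/allP => _ /mapP[c cM ->]; exact: M0.
- move=> k; rewrite big_map -SU -MS big_seq [RHS]big_seq.
  by apply: eq_bigr => c cM; rewrite cE.
- by rewrite big_map.
Qed.

Definition uncolumn (c : {set S} * nat) : fmaps * nat :=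
  ([fsfun x in S => (oapp (fun k => k \in c.1) false (insub x) : nat)], c.2).

Lemma uncolumn_val c (k : S) : (uncolumn c).1 (val k) = (k \in c.1).
Proof. by rewrite fsfunE (valP k) valK. Qed.

Lemma uncolumnK : cancel uncolumn column.
Proof.
case=> U n; congr (_, _); apply/setP => k; rewrite finset.inE uncolumn_val.
by case: (k \in _).
Qed.

Lemma word_array M n : wtype M [set: S]%SET n ->
  admissible (charf S) n (map uncolumn M) /\ map column (map uncolumn M) = M.
Proof.
case=> M0 MS Mn; split; last by rewrite mapK //; exact: uncolumnK.
split.
- by move=> _ /mapP[c cM ->]; exact: (allP M0).
- move=> x; rewrite big_map fsfunE; case: ifP => xS.
    rewrite -[x]/(val [` xS]%fset); have := MS [` xS]%fset.
    rewrite finset.inE => Hx; transitivity (nat_of_bool true) => //; rewrite -Hx.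
    by apply: eq_bigr => c _; rewrite uncolumn_val.
  by rewrite big1 // => c _; rewrite fsfunE xS.
- by rewrite big_map.
Qed.

End Arrays.

(** * Prime field spans *)

Section PrimeField.
Variables (C : fieldType) (p : nat).
Hypothesis pC : p \in [pchar C].

Lemma Fp_oppE (c : 'F_p) : ((- c : 'F_p) : nat)%:R = - (c : nat)%:R :> C.
Proof.
have pp := pcharf_prime pC.
apply/eqP; rewrite -addr_eq0 -natrD -(dvdn_pcharf pC).
by rewrite (dvdn_pcharf (pchar_Fp pp)) natrD !natr_Zp addNr.
Qed.

Lemma Fp_spanP (V : lmodType C) (X : V -> Prop) v : Fp_span p X v <-> zspan X v.
Proof.
split=> [[m [c [x [Xx ->]]]]|].
  apply: zspan_sum => k _; rewrite scaler_nat; apply: zspanMn.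
  by apply: zspan_in; exact: Xx.
elim=> {v} [v Xv||u v _ [m [c [x [Xx ->]]]] _ [m' [c' [x' [Xx' ->]]]]].
- exists 1%N, (fun=> 1), (fun=> v); split=> //.
  by rewrite big_ord1 (_ : nat_of_ord (1 : 'F_p) = 1%N) ?scale1r //.
- by exists 0%N, (fun=> 0), (fun=> 0); split=> [[]//|]; rewrite big_ord0.
exists (m + m')%N, (fun k => match fintype.split k with inl i => c i | inr j => - c' j end),
  (fun k => match fintype.split k with inl i => x i | inr j => x' j end).
split=> [k|]; first by case: fintype.split.
rewrite big_split_ord /= -sumrN; congr (_ + _); apply: eq_bigr => k _.
  by rewrite (unsplitK (inl k)).
by rewrite (unsplitK (inr k)) Fp_oppE scaleNr.
Qed.

End PrimeField.

(** * Partial sums as word sums *)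

Section Final.
Variables (R : realType) (F : finFieldType) (C : fieldType).
Variables (inF : {rmorphism F -> C}) (theta : C) (absv : C -> R).
Hypothesis hC : is_Cinf inF theta absv.
Variables (p e : nat).
Hypotheses (pC : p \in [pchar C]) (e_gt0 : (0 < e)%N) (cardF : #|F| = (p ^ e)%N).

Local Notation q := #|F|.
Local Notation pw := (powersum inF theta).

Let q1 : (1 < q)%N := q_gt1 pC e_gt0 cardF.

Section Partial.
Variable S : {fset Npos}.
Local Notation T := (S -> C).
Local Notation lZ := (zeta_letter inF theta (fun (k : S) (t : T) => t k)).

(** For monic polynomials, to compare absolute values is to compare degrees. *)
Lemma zeta_partial_wsum (U : {set S}) Sigma n M t D :
  admissible Sigma n M -> (forall k : S, Sigma (val k) = (k \in U)) ->
  zeta_partial inF theta absv M t D = wsum lZ (map (@column S) M) D t.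
Proof.
move=> HM SU; have [_ cE] := array_word HM SU.
rewrite wsum_nest nest_map.
transitivity (nest (fun c d => \sum_(x : {poly_D F} |
    ((x : {poly F}) \is monic) && ((size (x : {poly F})).-1 == d))
    chi inF c.1 t x / ev inF x theta ^+ c.2) M D); last first.
  apply: eq_nest => c d cM dD; rewrite /zeta_letter /letter -(monicsum_widen _ dD).
  apply: eq_big => [x|x /andP[mx _]].
    case: (boolP (_ \is monic)) => //= mx.
    by rewrite -(eqSS _ d) prednK // size_poly_gt0 monic_neq0.
  rewrite mulrC; congr (_ * _); rewrite /chi [RHS]big_mkcond; apply: eq_bigr => k _.
  by rewrite (cE _ _ cM); case: ifP; rewrite ?expr1.
rewrite -(@tuple_nest _ _ _ (fun x : {poly_D F} => (x : {poly F}) \is monic)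
  (fun x : {poly_D F} => (size (x : {poly F})).-1)
  (fun c (x : {poly_D F}) => chi inF c.1 t x / ev inF x theta ^+ c.2)).
apply: eq_bigl => a; case: (boolP (all _ a)) => //= ma.
have szx (x : {poly_D F}) : (x : {poly F}) \is monic ->
    size (x : {poly F}) = (size (x : {poly F})).-1.+1.
  by move=> mx; rewrite prednK // size_poly_gt0 monic_neq0.
rewrite (_ : all _ a) ?andbT; last first.
  by apply: sub_all ma => x mx; rewrite -szx // size_npoly.
apply: eq_in_sorted ma => x y mx my.
rewrite (absv_ev_monic hC mx (szx _ mx)) (absv_ev_monic hC my (szx _ my)).
by rewrite ltr_eXn2l // ltr1n.
Qed.

Lemma natr_forall (I : finType) (P : pred I) : [forall k, P k]%:R = \prod_k (P k)%:R :> C.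
Proof.
case: forallP => [HP|]; first by rewrite big1 // => k _; rewrite HP.
move=> /existsNP[k /negP kP]; rewrite (bigD1 k) //= (negbTE kP) mul0r //.
Qed.

(** As each variable occurs in exactly one column, the condition on the exponents is
a conjunction of one condition for each variable. *)
Lemma lambda_partial_ncoef n M (m : {ffun S -> nat}) D :
  admissible (charf S) n M ->
  lambda_partial inF theta M m D = ncoef inF theta (map (@column S) M) D m.
Proof.
move=> HM; have SU (k : S) : charf S (val k) = (k \in [set: S]%SET).
  by rewrite fsfunE (valP k) finset.inE.
have [[_ HS _] cE] := array_word HM SU.
have [J HJ] : exists J : S -> 'I_(size M),
    forall k j, (k \in (column S (tnth (in_tuple M) j)).1) = (j == J k).
  apply: (index_exists (A := fun j => (column S (tnth (in_tuple M) j)).1)) => k.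
  by have := HS k; rewrite finset.inE big_map big_tnth.
rewrite /ncoef /nestY nest_map.
have := @tuple_nest C _ 'I_D xpredT val (fun c d => pw d c.2 *
  \prod_(k in (column S c).1) (m k == (q ^ d)%N)%:R) M D.
rewrite [RHS](@eq_nest _ _ _ (fun c d => pw d c.2 *
  \prod_(k in (column S c).1) (m k == (q ^ d)%N)%:R)); last first.
  by move=> c d _ dD; rewrite (big_pred1 (Ordinal dD)).
move=> <-; rewrite /lambda_partial big_mkcondr /=; apply: eq_big => [a|a _].
  by rewrite all_predT /=; case: sorted => //=; apply/esym/allP => x _; apply: ltn_ord.
rewrite big_split /= (prod_index (fun k j => (m k == (q ^ tnth a j)%N)%:R) HJ).
rewrite -natr_forall.
have -> : [forall i, m i == (\sum_(j < size M) (tnth (in_tuple M) j).1 (val i) * q ^ tnth a j)%N]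
   = [forall k, m k == (q ^ tnth a (J k))%N].
  apply: eq_forallb => k; congr (_ == _).
  rewrite (bigD1 (J k)) //= cE ?mem_tnth // HJ eqxx mul1n big1 ?addn0 // => j jk.
  by rewrite cE ?mem_tnth // HJ (negbTE jk).
by case: ifP; rewrite ?mulr1 ?mulr0.
Qed.

End Partial.

End Final.

(** * The isomorphism *)

Section Isomorphism.
Variables (R : realType) (F : finFieldType) (C : fieldType).
Variables (inF : {rmorphism F -> C}) (theta : C) (absv : C -> R).
Hypothesis hC : is_Cinf inF theta absv.
Variables (p e : nat).
Hypotheses (pC : p \in [pchar C]) (e_gt0 : (0 < e)%N) (cardF : #|F| = (p ^ e)%N).
Variable S : {fset Npos}.
Hypothesis cardS : (#|{: S}| < #|F|)%N.

Local Notation q := #|F|.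
Local Notation pw := (powersum inF theta).
Local Notation T := (S -> C).
Local Notation y := (fun (k : S) (t : T) => t k).
Local Notation lZ := (zeta_letter inF theta y).
Local Notation lL := (lambda_letter inF theta y).
Local Notation conv := (converges absv).
Local Notation pconv := (pconv absv).
Local Notation Phi := (Fmap F theta S).
Local Notation Z := (Z_Sigma inF theta absv S p).
Local Notation L := (L_Sigma inF theta absv S p).
Local Notation Z0 := (Z_empty inF theta absv p).

Let th_transc := theta_transc hC.
Let q1 : (1 < q)%N := q_gt1 pC e_gt0 cardF.

Let words_swap (U : {set S}) n u : words lZ U n u <-> words lL U n u.
Proof. exact: (words_zeta_lambda pC e_gt0 cardF th_transc). Qed.

Lemma wordsZ_pconv (U : {set S}) n u : words lZ U n u -> exists f, pconv u f.
Proof. by move=> /words_swap; apply: (words_pconv hC pC e_gt0 cardF cardS). Qed.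

(** All word sums converge, so a combination of zeta values is the limit of the same
combination of their partial sums. *)
Lemma Z_SigmaP n (v : CS_fun C S) :
  Z n v <-> exists2 u, words lZ [set: S]%SET n u & pconv u v.
Proof.
have SU (k : S) : charf S (val k) = (k \in [set: S]%SET).
  by rewrite fsfunE (valP k) finset.inE.
rewrite /Z_Sigma (Fp_spanP pC); split.
  elim=> {v} [v [M HM ->]||v w _ [u Wu uv] _ [u' Wu' uw]]; last 2 first.
  - by exists 0; [exact: zspan0 | exact: (pconv0 hC)].
  - by exists (u - u'); [exact: zspanB | exact: (pconvB hC)].
  have [HW _] := array_word HM SU.
  have W : words lZ [set: S]%SET n (wsum lZ (map (@column S) M)).
    by apply: zspan_in; exists (map (@column S) M).
  exists (wsum lZ (map (@column S) M)) => // t.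
  have [f Hf] := wordsZ_pconv W.
  rewrite /zetaA (_ : zeta_partial inF theta absv M t =
    fun D => wsum lZ (map (@column S) M) D t); last first.
    by apply/funext => D; apply: (zeta_partial_wsum hC pC e_gt0 cardF) HM SU.
  by rewrite (climitE hC (Hf t)); exact: Hf.
case=> u Wu; elim: Wu v => {u} [u [M HM ->] v uv|v uv|u u' Wu IH Wu' IH' v uv].
- have [HA EM] := word_array HM.
  apply: zspan_in; exists (map (@uncolumn S) M) => //.
  apply/funext => t; rewrite /zetaA; apply/esym/(climitE hC).
  rewrite (_ : zeta_partial _ _ _ _ _ = fun D => wsum lZ M D t); first exact: uv.
  apply/funext => D.
  by rewrite (zeta_partial_wsum hC pC e_gt0 cardF t D HA SU) EM.
- by rewrite (pconv_unique hC uv (pconv0 hC (S:=S))); exact: zspan0.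
have [f uf] := wordsZ_pconv Wu; have [g u'g] := wordsZ_pconv Wu'.
rewrite (pconv_unique hC uv (pconvB hC uf u'g)).
by apply: zspanB; [exact: IH | exact: IH'].
Qed.

(** Partial sums without variables do not depend on the set of variables, so that
multiple zeta values can be multiplied with functions inside one algebra of
words. *)
Lemma Z_emptyP n (a : C) : Z0 n a ->
  exists2 u, words lZ finset.set0 n u & pconv u (fun=> a).
Proof.
case=> f; rewrite /Z_Sigma => /(Fp_spanP pC) Hf <-.
elim: Hf => {f} [f [M HM ->]||v w _ [u Wu uv] _ [u' Wu' uw]]; last 2 first.
- by exists 0; [exact: zspan0 | move=> t; exact: (conv_cst hC)].
- by exists (u - u'); [exact: zspanB | move=> t; apply: (conv_sub hC)].
have S0 (k : S) : charf fset0 (val k) = (k \in (finset.set0 : {set S})).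
  by rewrite fsfunE finset.inE.
have [HW _] := array_word HM S0.
have W : words lZ finset.set0 n (wsum lZ (map (@column S) M)).
  by apply: zspan_in; exists (map (@column S) M).
exists (wsum lZ (map (@column S) M)) => // t.
have [g Hg] := wordsZ_pconv W.
rewrite /zetaA (_ : zeta_partial inF theta absv M _ =
  fun D => wsum lZ (map (@column S) M) D t).
  by rewrite (climitE hC (Hg t)); exact: Hg.
apply/funext => D; rewrite -(zeta_partial_wsum hC pC e_gt0 cardF t D HM S0).
apply: eq_bigr => a' _; apply: eq_bigr => j _; congr (_ / _).
rewrite /chi !big1 // => k _.
have [_ HM0 _] := HM.
  suff -> : (tnth (in_tuple M) j).1 (val k) = 0%N by [].
  have := HM0 (val k); rewrite fsfunE big_tnth => /eqP.
  by rewrite sum_nat_eq0 => /forallP/(_ j)/eqP.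
by have := fsvalP k; rewrite inE.
Qed.

Lemma Z_zero n : Z n 0.
Proof. by apply/(Fp_spanP pC); exact: zspan0. Qed.

Lemma Z_sub n u v : Z n u -> Z n v -> Z n (u - v).
Proof. by move=> /(Fp_spanP pC) Hu /(Fp_spanP pC) Hv; apply/(Fp_spanP pC)/zspanB. Qed.

Lemma Z_scale m n (a : C) v : Z0 m a -> Z n v -> Z (m + n)%N (a *: v).
Proof.
move=> /Z_emptyP[u Wu ua] /Z_SigmaP[w Ww wv]; apply/Z_SigmaP; exists (u * w).
  rewrite -[[set: S]%SET]finset.set0U; apply: words_mul => //.
    exact: (zeta_letter_closed th_transc).
  by rewrite finset.disjoints_subset finset.sub0set.
by move=> t; apply: (conv_mul hC (ua t) (wv t)).
Qed.

Lemma Fmap_cases (m : {ffun S -> nat}) :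
  (exists2 i : {ffun S -> nat}, m = qpow F i & forall f, Phi f m = Fcoef F theta f i) \/
  (exists2 k, forall d, m k <> (q ^ d)%N & forall f, Phi f m = 0).
Proof.
have [[i Hi]|no] := pselect (exists i : {ffun S -> nat}, forall k, m k = (q ^ i k)%N).
  left; exists i; first by apply/ffunP => k; rewrite ffunE Hi.
  move=> f; rewrite /Fmap (_ : [set j : {ffun S -> nat} | _]%classic = [set i]%classic).
    by rewrite fsbig_set1.
  apply/seteqP; split=> [j /= Hj|_ -> //].
  apply/ffunP => k; apply/eqP; rewrite -(eqn_exp2l _ _ q1); apply/eqP.
  by rewrite -Hj -Hi.
right; have [k Hk] : exists k, forall d, m k <> (q ^ d)%N.
  apply: contrapT => /forallNP H; apply: no.
  have H' k : exists d, m k = (q ^ d)%N.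
    by have /existsNP[d /contrapT] := H k; exists d.
  by have [g Hg] := boolp.choice H'; exists (finfun g) => k; rewrite ffunE.
exists k => // f; rewrite /Fmap (_ : [set j : {ffun S -> nat} | _]%classic = set0).
  by rewrite fsbig_set0.
by apply/seteqP; split=> // j /= /(_ k) /Hk.
Qed.

Lemma FmapB f g : Phi (f - g) = Phi f - Phi g.
Proof.
apply/funext => m; rewrite -[RHS]/(Phi f m - Phi g m).
have [[i _ H]|[k _ H]] := Fmap_cases m; rewrite !H ?FcoefB //.
by rewrite subrr.
Qed.

Lemma FmapZ (a : C) f : Phi (a *: f) = a *: Phi f.
Proof.
apply/funext => m; rewrite -[RHS]/(a * Phi f m).
have [[i _ H]|[k _ H]] := Fmap_cases m; rewrite !H ?FcoefZ //.
by rewrite mulr0.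
Qed.

Lemma Fmap0 : Phi 0 = 0.
Proof. by rewrite -(subrr 0) FmapB subrr. Qed.

Lemma FmapD f g : Phi (f + g) = Phi f + Phi g.
Proof. by rewrite -[g in LHS]opprK FmapB -[- g]sub0r FmapB Fmap0 sub0r opprK. Qed.

Lemma Fmap_sum I (r : seq I) (f : I -> CS_fun C S) :
  Phi (\sum_(i <- r) f i) = \sum_(i <- r) Phi (f i).
Proof. by elim/big_rec2: _ => [|i u v _ <-]; [exact: Fmap0 | exact: FmapD]. Qed.

(** On a word sum in the letters built from the Newton basis, the map reads off
the Newton coefficients, which are the coefficients of the series lambda. *)
Lemma Fmap_wsum n M f : admissible (charf S) n M ->
  pconv (wsum lL (map (@column S) M)) f -> Phi f = lambdaA inF theta absv M.
Proof.
move=> HM Hf.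
have SU (k : S) : charf S (val k) = (k \in [set: S]%SET).
  by rewrite fsfunE (valP k) finset.inE.
have [HW _] := array_word HM SU.
have nw := newton_wsum hC pC e_gt0 cardF cardS HW.
apply/funext => m; rewrite /lambdaA; apply/esym/(climitE hC).
have -> : lambda_partial inF theta M m = fun D => ncoef inF theta (map (@column S) M) D m.
  by apply/funext => D; rewrite (lambda_partial_ncoef inF theta m D HM).
have [[i -> H]|[k mk H]] := Fmap_cases m; rewrite H.
  exact: (newton_Fcoef hC pC e_gt0 cardF i nw Hf).
rewrite (_ : (fun D => _) = fun=> 0); first exact: (conv_cst hC).
apply/funext => D; apply: (nestY_eq0 inF theta (k := k) HW) => d _.
by case: eqP => // /mk.
Qed.

Lemma Fmap_mem n v : Z n v -> L n (Phi v).
Proof.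
move=> /Z_SigmaP[u /words_swap Wu uv]; apply/(Fp_spanP pC).
elim: Wu v uv => {u} [u [M HM ->] v uv|v uv|u u' Wu IH Wu' IH' v uv].
- have [HA EM] := word_array HM; apply: zspan_in.
  exists (map (@uncolumn S) M) => //.
  by apply: (Fmap_wsum HA); rewrite EM.
- by rewrite (pconv_unique hC uv (pconv0 hC (S:=S))) Fmap0; exact: zspan0.
have [f uf] := words_pconv hC pC e_gt0 cardF cardS Wu.
have [g u'g] := words_pconv hC pC e_gt0 cardF cardS Wu'.
rewrite (pconv_unique hC uv (pconvB hC uf u'g)) FmapB.
by apply: zspanB; [exact: IH | exact: IH'].
Qed.

Lemma Fmap_onto n w : L n w -> exists2 v, Z n v & Phi v = w.
Proof.
move=> /(Fp_spanP pC); elim=> {w} [w [M HM ->]||w w' _ [v Zv <-] _ [v' Zv' <-]].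
- have SU (k : S) : charf S (val k) = (k \in [set: S]%SET).
    by rewrite fsfunE (valP k) finset.inE.
  have [HW _] := array_word HM SU.
  have W : words lL [set: S]%SET n (wsum lL (map (@column S) M)).
    by apply: zspan_in; exists (map (@column S) M).
  have [f Hf] := words_pconv hC pC e_gt0 cardF cardS W.
  exists f; last exact: (Fmap_wsum HM Hf).
  by apply/Z_SigmaP; exists (wsum lL (map (@column S) M)) => //; apply/words_swap.
- by exists 0; [exact: Z_zero | exact: Fmap0].
- by exists (v - v'); [exact: Z_sub | exact: FmapB].
Qed.

Lemma gsum_full v : gsum Z v -> exists2 u, full_words inF theta u & pconv u v.
Proof.
case=> N [x [Zx ->]]; elim: N => [|N [u Fu uv]].
  by exists 0; [exact: zspan0 | rewrite big_ord0; exact: (pconv0 hC)].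
have /Z_SigmaP[w /words_swap Ww wx] := Zx N.
exists (u + w); first by apply: zspanD => //; apply: zspan_in; exists N.
by rewrite big_ord_recr /= => t; apply: (conv_add hC (uv t) (wx t)).
Qed.

Lemma gsum_entire v : gsum Z v -> entire absv S v.
Proof.
move=> /gsum_full[u Fu uv].
have [c uc] := full_words_taylor hC pC e_gt0 cardF cardS Fu.
exact: (taylor_entire hC uc uv).
Qed.

Lemma Fmap_inj v w : gsum Z v -> gsum Z w -> Phi v = Phi w -> v = w.
Proof.
move=> /gsum_full[u Fu uv] /gsum_full[u' Fu' uw] E.
apply/eqP; rewrite -subr_eq0; apply/eqP.
have [c uc] := full_words_newton hC pC e_gt0 cardF cardS (zspanB Fu Fu').
apply: (newton_inj hC pC e_gt0 cardF uc (pconvB hC uv uw)) => i.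
have := congr1 (fun g => g (qpow F i)) (FmapB v w); rewrite E subrr => H.
have [[j jE Hj]|[k /(_ (i k))]] := Fmap_cases (qpow F i); last by rewrite ffunE.
have -> : i = j.
  apply/ffunP => k; apply/eqP; rewrite -(eqn_exp2l _ _ q1).
  by have := congr1 (fun g : {ffun S -> nat} => g k) jE; rewrite !ffunE => /eqP.
by rewrite -Hj.
Qed.

End Isomorphism.

Local Open Scope classical_set_scope.

Theorem theorem5p2 (p e : nat) (R : realType) (F : finFieldType) (C : fieldType)
    (inF : {rmorphism F -> C}) (theta : C) (absv : C -> R) (S : {fset Npos})
    (hp : prime p) (he : (0 < e)%N) (hF : #|F| = (p ^ e)%N)
    (hC : is_Cinf inF theta absv) (hS : (#|` S| < #|F|)%N) :
  gsum (Z_Sigma inF theta absv S p) `<=` entire absv S /\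
  graded_module_iso (Z_empty inF theta absv p)
    (Z_Sigma inF theta absv S p) (L_Sigma inF theta absv S p)
    (Fmap F theta S).
Proof.
have pC : p \in [pchar C] := rmorph_pchar inF (card_finPcharP hF hp).
have cS : (#|{: S}| < #|F|)%N by rewrite -cardfE.
have mem n v := @Fmap_mem _ _ _ _ _ _ hC _ _ pC he hF S cS n v.
have onto n w := @Fmap_onto _ _ _ _ _ _ hC _ _ pC he hF S cS n w.
have mapsto v : gsum (Z_Sigma inF theta absv S p) v ->
    gsum (L_Sigma inF theta absv S p) (Fmap F theta S v).
  case=> N [x [Zx ->]]; exists N, (fun n => Fmap F theta S (x n)).
  by split=> [n|]; [exact: mem | rewrite (Fmap_sum theta pC he hF)].
split; first by move=> v; exact: (gsum_entire hC pC he hF cS).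
split.
- split; [exact: Z_zero | by move=> n u v; exact: Z_sub |].
  by move=> m n a v; exact: (Z_scale hC pC he hF cS).
- split=> [n|n u v|m n a w Za].
  + by apply/(Fp_spanP pC); exact: zspan0.
  + by move=> /(Fp_spanP pC) Hu /(Fp_spanP pC) Hv; apply/(Fp_spanP pC)/zspanB.
  + move=> /onto[v Zv <-]; rewrite -(FmapZ theta pC he hF).
    exact/mem/(Z_scale hC pC he hF cS).
- by move=> u v _ _; exact: (FmapD theta pC he hF).
- by move=> a v _ _; exact: (FmapZ theta pC he hF).
- split.
  + by move=> v; exact: mapsto.
  + by move=> u v /set_mem Zu /set_mem Zv; exact: (Fmap_inj hC pC he hF cS Zu Zv).
  + move=> w [N [x [Lx ->]]].
    have H n : exists v, Z_Sigma inF theta absv S p n v /\ Fmap F theta S v = x n.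
      by have [v Zv <-] := onto _ _ (Lx n); exists v.
    have [g Hg] := boolp.choice H.
    exists (\sum_(n < N) g n).
      by exists N, g; split=> // n; case: (Hg n).
    rewrite (Fmap_sum theta pC he hF); apply: eq_bigr => n _.
    by case: (Hg n).
- move=> n; apply/seteqP; split=> [_ [v Zv <-]|w /onto[v Zv <-]]; first exact: mem.
  by exists v.
Qed.
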